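(* $\mathbb F_0=\mathbb F_{\sqrt{1+x^2}}=\mathbb F_{\sqrt x}\cap\mathbb F_{TR}$. That is, a real number is an origami number if and only if it is constructible by compass and straightedge and is a totally real algebraic number.
   Context: An origami pair is a pair $(\mathcal P,\mathcal L)$ where $\mathcal P\subset\mathbb R^2$ is a set of points and $\mathcal L$ is a collection of lines in $\mathbb R^2$ such that: (i) the intersection point of any two non-parallel lines of $\mathcal L$ lies in $\mathcal P$; (ii) for any two distinct points of $\mathcal P$, the line through them is in $\mathcal L$; (iii) for any two distinct points of $\mathcal P$, the perpendicular bisector of the segment joining them is in $\mathcal L$; (iv) if $L_1,L_2\in\mathcal L$, then every line equidistant from $L_1$ and $L_2$ is in $\mathcal L$ (the midline if they are parallel, the angle bisectors if they intersect); (v) if $L_1,L_2\in\mathcal L$, then the mirror reflection of $L_2$ across $L_1$ is in $\mathcal L$. A set $\mathcal P\subset\mathbb R^2$ is closed under origami constructions if there is a collection of lines $\mathcal L$ with $(\mathcal P,\mathcal L)$ an origami pair. The set of origami constructible points is $\mathcal P_0=\bigcap\{\mathcal P : (0,0),(0,1)\in\mathcal P \text{ and } \mathcal P \text{ is closed under origami constructions}\}$. The set of origami numbers is $\mathbb F_0=\{\alpha\in\mathbb R : \exists v_1,v_2\in\mathcal P_0,\ |\alpha|=\operatorname{dist}(v_1,v_2)\}$. $\mathbb F_{\sqrt{1+x^2}}$ denotes the smallest subfield of $\mathbb C$ that, together with any element $x$, contains a square root of $1+x^2$. $\mathbb F_{\sqrt x}$ denotes the smallest subfield of $\mathbb C$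 that contains a square root of each of its elements. An algebraic number is totally real if all roots of its minimal polynomial over $\mathbb Q$ are real; $\mathbb F_{TR}$ denotes the set of totally real algebraic numbers. *)

(* Defs.v *)
From mathcomp Require Import all_boot all_algebra all_reals.
From mathcomp Require Export complex.
Import GRing.Theory Num.Theory.
Set Implicit Arguments. Unset Strict Implicit. Unset Printing Implicit Defensive.
Local Open Scope ring_scope.

Section Origami.
Variable R : realType.

Definition point := (R * R)%type.

Definition sqdist (p q : point) : R := (p.1 - q.1) ^+ 2 + (p.2 - q.2) ^+ 2.

Definition is_line (l : point -> Prop) : Prop :=
  exists a b c : R, (a != 0 \/ b != 0) /\ forall p : point, l p <-> a * p.1 + b * p.2 = c.

(* the line through p and q (a line when p <> q) *)
Definition line_through (p q : point) : point -> Prop :=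
  fun r => (q.1 - p.1) * (r.2 - p.2) = (q.2 - p.2) * (r.1 - p.1).

(* perpendicular bisector of the segment pq (a line when p <> q) *)
Definition perp_bisector (p q : point) : point -> Prop :=
  fun r => sqdist r p = sqdist r q.

(* every point of M is at the same distance from L1 as from L2
   (distance point-line = infimum of distances, attained for lines) *)
Definition equidistant (M L1 L2 : point -> Prop) : Prop :=
  forall r, M r ->
    (forall p1, L1 p1 -> exists p2, L2 p2 /\ sqdist r p2 <= sqdist r p1) /\
    (forall p2, L2 p2 -> exists p1, L1 p1 /\ sqdist r p1 <= sqdist r p2).

Definition mirror (L1 : point -> Prop) (r r' : point) : Prop :=
  (L1 r /\ r' = r) \/ (r <> r' /\ forall x, L1 x <-> perp_bisector r r' x).

Definition reflect_line (L1 L2 : point -> Prop) : point -> Prop :=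
  fun r' => exists r, L2 r /\ mirror L1 r r'.

Definition origami_pair (P : point -> Prop) (L : (point -> Prop) -> Prop) : Prop :=
  (forall l, L l -> is_line l) /\
  (forall l1 l2, L l1 -> L l2 ->
     forall p, (forall x, (l1 x /\ l2 x) <-> x = p) -> P p) /\
  (forall p q, P p -> P q -> p <> q -> L (line_through p q)) /\
  (forall p q, P p -> P q -> p <> q -> L (perp_bisector p q)) /\
  (forall L1 L2, L L1 -> L L2 -> ~ (forall x, L1 x <-> L2 x) ->
     forall M, is_line M -> equidistant M L1 L2 -> L M) /\
  (forall L1 L2, L L1 -> L L2 -> L (reflect_line L1 L2)).

Definition origami_closed (P : point -> Prop) : Prop := exists L, origami_pair P L.

Definition P0 (p : point) : Prop :=
  forall P, P (0, 0) -> P (0, 1) -> origami_closed P -> P p.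

Definition origami_number (a : R) : Prop :=
  exists v1 v2, P0 v1 /\ P0 v2 /\ `|a| = Num.sqrt (sqdist v1 v2).

Definition is_subfield (S : R[i] -> Prop) : Prop :=
  S 1 /\ (forall x y, S x -> S y -> S (x - y)) /\ (forall x y, S x -> S y -> S (x * y)) /\
  (forall x, S x -> x != 0 -> S x^-1).

Definition F_sqrt1x2 (z : R[i]) : Prop :=
  forall S, is_subfield S -> (forall x, S x -> exists y, S y /\ y ^+ 2 = 1 + x ^+ 2) -> S z.

Definition F_sqrtx (z : R[i]) : Prop :=
  forall S, is_subfield S -> (forall x, S x -> exists y, S y /\ y ^+ 2 = x) -> S z.

Definition is_minpoly (p : {poly rat}) (z : R[i]) : Prop :=
  p \is monic /\ root (map_poly ratr p) z /\
  forall q : {poly rat}, q != 0 -> root (map_poly ratr q) z -> (size p <= size q)%N.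

Definition totally_real (z : R[i]) : Prop :=
  exists p, is_minpoly p z /\ forall w : R[i], root (map_poly ratr p) w -> Im w = 0.

End Origami.

(* Main.v *)
From HB Require Import structures.
Require Import Defs.
From mathcomp Require Import all_boot all_order all_fingroup all_algebra all_solvable all_field.
From mathcomp Require Import all_classical all_reals.
From mathcomp Require Import complex ring lra.
Import Order.TTheory GRing.Theory Num.Theory.
Set Implicit Arguments. Unset Strict Implicit. Unset Printing Implicit Defensive.
Local Open Scope ring_scope.

(** Origami numbers. If K is a real field closed under sqrt(1 + x^2), lines with
    coefficients in K can be normalised to have unit normals in K, so K^2 with these
    lines is an origami pair. Conversely, in any origami pair containing (0,0) and
    (0,1), the abscissas of the vertical lines form a field closed under sqrt(1 + x^2).

    Totally real numbers. Let z be totally real and obtained by iterated square roots,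
    L a number field normal over Q containing everything in sight, and S a field closed
    under sqrt(1 + x^2). An automorphism of L of odd order fixes every iterated square
    root, so the normal subfield E of the elements with real conjugates that are fixed
    by automorphisms of odd order contains z, and Gal(E/Q) is a 2-group. If K, the part
    of E lying in S, were smaller than E, some y in E \ K would satisfy d = y^2 in K,
    with d totally positive. The trace form Tr(f(d) g(d) / d) on rational polynomials of
    small degree is then positive definite, and evaluating its inverse at the vector
    (1, d, d^2, ...) writes d as a rational positive semidefinite form in elements of S.
    Completing squares, d is a sum of squares of S, hence a square in S, so that y is
    in S: a contradiction. *)

(** * Number fields inside an algebraically closed field *)

Section NumberFields.
Variable C : numClosedFieldType.
Notation QtoC := (ratr : rat -> C).
Notation pQtoC := (map_poly QtoC).
Implicit Types (x y z : C) (s : seq C).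

Lemma minimal_poly_exists z : algebraicOver QtoC z ->
  exists p : {poly rat}, [/\ p \is monic, root (pQtoC p) z &
    forall q : {poly rat}, q != 0 -> root (pQtoC q) z -> (size p <= size q)%N].
Proof.
move=> [p0 nz_p0 p0z].
pose P n := `[< exists2 q : {poly rat}, q != 0 /\ root (pQtoC q) z & size q = n >].
have exP : exists n, P n by exists (size p0); apply/asboolP; exists p0.
case: (ex_minnP exP) => n /asboolP[p [nz_p pz] sz_p] min_n.
have lc_p : lead_coef p != 0 by rewrite lead_coef_eq0.
exists ((lead_coef p)^-1 *: p); split.
- by rewrite monicE lead_coefZ mulVf.
- by rewrite linearZ /= rootZ // ?fmorph_eq0 ?invr_eq0.
- move=> q nz_q qz; rewrite size_scale ?invr_eq0 // sz_p.
  by apply: min_n; apply/asboolP; exists q.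
Qed.

Lemma algebraic_sqrt x y : y ^+ 2 = x -> algebraicOver QtoC x -> algebraicOver QtoC y.
Proof.
move=> y2 [p nz_p px]; exists (p \Po 'X^2).
  by rewrite comp_poly_eq0 // size_polyXn.
by rewrite map_comp_poly map_polyXn /root horner_comp hornerXn y2.
Qed.

(** Induction with the primitive element theorem. Writing [z] as a combination of [s] with natural
    coefficients is what later places it in the field generated by the preimages of [s]. *)
Lemma primitive_element s : (forall x, x \in s -> algebraicOver QtoC x) ->
  exists z (a : nat -> nat) (ps : seq {poly rat}), [/\ algebraicOver QtoC z,
    z = \sum_(i < size s) s`_i *+ a i & s = [seq (pQtoC p).[z] | p <- ps]].
Proof.
elim: s => [_|x s IHs algs].
  by exists 0, id, [::]; rewrite big_ord0; split=> //; exact: algebraic0.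
have [|z [a [ps [[rz nz_rz rz0] Dz Ds]]]] := IHs; first by move=> y sy; apply: algs; rewrite inE sy orbT.
have [rx nz_rx rx0] := algs x (mem_head _ _).
have [rNz nz_rNz rNz0] : algebraicOver QtoC (- z) by apply: algebraic_opp; exists rz.
have pchar0_Q: [pchar rat] =i pred0 by apply: pchar_num.
(* The theorem produces [x *+ n - (- z)], so it is applied to [- z] to obtain a sum. *)
have [n [[pz Dpz] [px Dpx]]] := pchar0_PET nz_rNz rNz0 nz_rx rx0 pchar0_Q.
rewrite opprK in Dpz Dpx.
exists (x *+ n + z), (fun i => if i is j.+1 then a j else n),
  (px :: [seq p \Po (- pz) | p <- ps]); split.
- rewrite -mulr_natl; apply: algebraic_add; last by exists rz.
  apply: algebraic_mul; last by exists rx.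
  by rewrite -(ratr_nat C n); apply: algebraic_id.
- by rewrite big_ord_recl /= Dz.
- rewrite /= [in LHS]Ds -map_comp; congr (_ :: _); first by rewrite Dpx.
  apply: eq_map => p /=.
  by rewrite /= map_comp_poly horner_comp rmorphN hornerN Dpz opprK.
Qed.

Lemma splitting_closure s : (forall x, x \in s -> algebraicOver QtoC x) ->
  exists (P : {poly rat}) (t : seq C), [/\ P != 0, {subset s <= t} &
    pQtoC P = \prod_(a <- t) ('X - a%:P)].
Proof.
elim: s => [_|x s IHs algs].
  by exists 1, [::]; rewrite oner_neq0 big_nil rmorph1; split.
have [|P [t [nzP st DP]]] := IHs; first by move=> y sy; apply: algs; rewrite inE sy orbT.
have [p [mon_p px _]] := minimal_poly_exists (algs x (mem_head _ _)).
have [r Dr] := closed_field_poly_normal (pQtoC p).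
rewrite (monicP _) ?monic_map // scale1r in Dr.
exists (p * P), (r ++ t); split.
- by rewrite mulf_neq0 // monic_neq0.
- move=> y; rewrite inE mem_cat => /predU1P[->|/st->]; last by rewrite orbT.
  by rewrite -root_prod_XsubC -Dr px.
- by rewrite rmorphM /= Dr DP big_cat.
Qed.

(** Take a polynomial [P] over the rationals having [s] among its roots in [C], and a primitive
    element of all its roots, with minimal polynomial [r]. Then [Q[X]/(r)] embeds in [C] and is
    generated by the roots of [P], so it is a splitting field. *)
Lemma number_field_exists s : (forall x, x \in s -> algebraicOver QtoC x) ->
  exists (L : splittingFieldType rat) (iota : {rmorphism L -> C}),
    forall x, x \in s -> exists u, iota u = x.
Proof.
move=> algs; have [P [t [nzP st DP]]] := splitting_closure algs.
have algt x : x \in t -> algebraicOver QtoC x.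
  by move=> tx; exists P => //; rewrite DP root_prod_XsubC.
have [z [a [ps [algz Dz Dt]]]] := primitive_element algt.
have [r [mon_r rz0 min_r]] := minimal_poly_exists algz.
have nz_r := monic_neq0 mon_r.
have irr_r: irreducible_poly r.
  by apply/(subfx_irreducibleP rz0 nz_r) => q qz0 nzq; apply: min_r.
have [Qs [QsC [w [QsCw QsCq w_gen]]]] : exists (Qs : fieldExtType rat)
    (QsC : {rmorphism Qs -> C}) (w : Qs), [/\ QsC w = z, forall a, QsC a%:A = ratr a
    & forall u, exists p, u = (map_poly (in_alg Qs) p).[w]].
  exists (SubFieldExtType rz0 irr_r), (@subfx_inj _ _ (ratr : {rmorphism rat -> C}) z r).
  exists (subfx_root (ratr : {rmorphism rat -> C}) z r).
  split; [exact: subfx_inj_root | exact: subfx_inj_base |].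
  by move=> u; have [p ->] := subfxEroot rz0 nz_r u; exists p.
have QsCZ (q : {poly rat}) : pQtoC q = map_poly QsC (map_poly (in_alg Qs) q).
  by rewrite -map_poly_comp; apply: eq_map_poly => b; rewrite /= QsCq.
pose t' := [seq (map_poly (in_alg Qs) p).[w] | p <- ps] : seq Qs.
have Dt' : map QsC t' = t.
  rewrite Dt -map_comp; apply: eq_map => p /=.
  by rewrite -horner_map /= QsCw QsCZ.
have DP' : map_poly (in_alg Qs) P = \prod_(b <- t') ('X - b%:P) :> {poly Qs}.
  apply: (map_poly_inj QsC); rewrite -QsCZ DP -Dt' big_map rmorph_prod.
  by apply: eq_bigr => b _; rewrite /= rmorphB /= map_polyX map_polyC.
have w_t' : w \in <<1 & t'>>%VS.
  have sz_t' : size t' = size t by rewrite -(size_map QsC) Dt'.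
  have ->: w = \sum_(i < size t) t'`_i *+ a i.
    apply: (fmorph_inj QsC); rewrite QsCw Dz rmorph_sum /=; apply: eq_bigr => i _.
    by rewrite rmorphMn -(nth_map _ 0) ?sz_t' // Dt'.
  by apply: rpred_sum => i _; rewrite rpredMn ?seqv_sub_adjoin ?mem_nth ?sz_t'.
have split_ax : splitting_field_axiom Qs.
  exists (map_poly (in_alg Qs) P).
    by apply/polyOverP => i; rewrite coef_map /= memvZ ?mem1v.
  exists t'; first by rewrite DP' eqpxx.
  apply/vspaceP=> x; rewrite memvf; have [p ->] := w_gen x.
  by apply: rpred_horner => //; apply/polyOverP => i; rewrite coef_map /= memvZ ?mem1v.
pose L : splittingFieldType rat :=
  HB.pack Qs (FieldExt_isSplittingField.Build rat Qs split_ax).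
exists L, QsC => x /st; rewrite -Dt' => /mapP[u _ ->]; by exists u.
Qed.

(** This is [totally_real] over any closed field, with [Num.real] in place of a vanishing imaginary
    part. *)
Definition conj_real z := exists p : {poly rat}, [/\ p \is monic, root (pQtoC p) z,
  forall q : {poly rat}, q != 0 -> root (pQtoC q) z -> (size p <= size q)%N &
  forall w, root (pQtoC p) w -> w \is Num.real].

(** * Conjugates as images under the Galois group *)

Section Conjugates.
Variables (L : splittingFieldType rat) (iota : {rmorphism L -> C}).
Implicit Types (u : L) (g : gal_of {:L}).
Local Notation G := 'Gal({:L} / 1)%g.

Lemma galois_over_rat (K : {subfield L}) : galois K {:L}.
Proof.
rewrite /galois subvf normalFieldf andbT /=; apply/separableP => u _.
by apply: pcharf0_separable; move=> n; rewrite pchar_lalg pchar_num.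
Qed.

Lemma mem_gal_rat g : g \in G.
Proof. by rewrite gal_kHom ?sub1v // k1AHom. Qed.

Lemma embed_alg (q : {poly rat}) : map_poly iota (map_poly (in_alg L) q) = pQtoC q.
Proof. by rewrite -map_poly_comp; apply: eq_map_poly => a /=; rewrite alg_num_field fmorph_rat. Qed.

Lemma minimal_poly_minPoly u (p : {poly rat}) : p \is monic -> root (pQtoC p) (iota u) ->
  (forall q : {poly rat}, q != 0 -> root (pQtoC q) (iota u) -> (size p <= size q)%N) ->
  pQtoC p = map_poly iota (minPoly 1 u).
Proof.
move=> mon_p pu min_p; rewrite -embed_alg; congr map_poly.
have /polyOver1P[q Dq] := minPolyOver 1 u.
have root_u (r : {poly rat}) : root (pQtoC r) (iota u) = root (map_poly (in_alg L) r) u.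
  by rewrite -embed_alg fmorph_root.
apply/eqP; rewrite -eqp_monic ?map_monic ?monic_minPoly //.
rewrite eqp_sym -dvdp_size_eqp; last first.
  apply: minPoly_dvdp; last by rewrite -root_u.
  by apply/polyOver1P; exists p.
rewrite eqn_leq dvdp_leq ?map_poly_eq0 ?monic_neq0 //=; last first.
  by apply: minPoly_dvdp; rewrite -?root_u //; apply/polyOver1P; exists p.
rewrite Dq !size_map_poly; apply: min_p.
  by rewrite -(map_poly_eq0 (in_alg L)) -Dq monic_neq0 ?monic_minPoly.
by rewrite root_u -Dq root_minPoly.
Qed.

Lemma algebraic_embed u : algebraicOver QtoC (iota u).
Proof.
have /polyOver1P[q Dq] := minPolyOver 1 u; exists q.
  by rewrite -(map_poly_eq0 (in_alg L)) -Dq monic_neq0 ?monic_minPoly.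
by rewrite -embed_alg -Dq fmorph_root root_minPoly.
Qed.

(** As [L] is normal, the minimal polynomial splits into factors with roots [g u], so its roots in
    [C] are exactly the [iota (g u)]. *)
Lemma conj_realP u : conj_real (iota u) <-> (forall g, iota (g u) \is Num.real).
Proof.
split=> [[p [mon_p pu min_p real_p]] g | real_u].
  apply: real_p; rewrite (minimal_poly_minPoly mon_p pu min_p) fmorph_root.
  by rewrite (root_minPoly_gal (sub1v _) (mem_gal_rat g)) ?memvf.
have [p [mon_p pu min_p]] := minimal_poly_exists (algebraic_embed u).
exists p; split=> // w; rewrite (minimal_poly_minPoly mon_p pu min_p).
have /(galois_factors (sub1v _))/(_ u (memvf u)) [r /= [_ _ ->]] := galois_over_rat 1.
rewrite rmorph_prod big_map (eq_bigr (fun g : gal_of {:L} => 'X - (iota (g u))%:P)).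
  rewrite -(big_map (fun g : gal_of {:L} => iota (g u)) xpredT (fun b => 'X - b%:P)).
  by rewrite root_prod_XsubC => /mapP[g _ ->].
by move=> g _; rewrite rmorphB /= map_polyX map_polyC.
Qed.

End Conjugates.
End NumberFields.

(** * Quadratic forms over Pythagorean fields *)

Section QuadraticForms.

Definition qform (K : fieldType) n (A : 'I_n -> 'I_n -> K) (x : 'I_n -> K) :=
  \sum_j (\sum_i x i * A i j) * x j.

(** Schur complement of the corner entry. If that entry is 0, so is its inverse, and the form is
    merely restricted to the other variables. *)
Definition schur (K : fieldType) n (A : 'I_n.+1 -> 'I_n.+1 -> K) (i j : 'I_n) :=
  A (lift ord0 i) (lift ord0 j)
    - (A ord0 ord0)^-1 * A ord0 (lift ord0 i) * A ord0 (lift ord0 j).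

(** Completing the square in the first variable; when the corner is 0 the whole first row vanishes
    and there is nothing to complete. *)
Lemma qform_schur (K : fieldType) n (A : 'I_n.+1 -> 'I_n.+1 -> K) (x : 'I_n.+1 -> K) :
  (forall i j, A i j = A j i) -> (A ord0 ord0 = 0 -> forall j, A ord0 j = 0) ->
  qform A x = A ord0 ord0 * (x ord0 +
      (A ord0 ord0)^-1 * \sum_j A ord0 (lift ord0 j) * x (lift ord0 j)) ^+ 2
    + qform (schur A) (fun j => x (lift ord0 j)).
Proof.
move=> symA A0; set a := A ord0 ord0; set b := \sum_j _.
have -> : qform (schur A) (fun j => x (lift ord0 j)) =
    qform (fun i j => A (lift ord0 i) (lift ord0 j)) (fun j => x (lift ord0 j)) - a^-1 * b ^+ 2.
  rewrite /qform expr2 mulrA [_ * b]mulr_sumr -sumrB; apply: eq_bigr => j _.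
  rewrite [X in X * _](eq_bigr (fun i => x (lift ord0 i) * A (lift ord0 i) (lift ord0 j)
     - (A ord0 (lift ord0 i) * x (lift ord0 i)) * (a^-1 * A ord0 (lift ord0 j)))); last first.
    by move=> i _; rewrite /schur -/a; ring.
  rewrite sumrB -mulr_suml -/b mulrBl; congr (_ - _).
  by ring.
have col0 : \sum_i x i * A i ord0 = x ord0 * a + b.
  by rewrite big_ord_recl; congr (_ + _); apply: eq_bigr => i _; rewrite symA mulrC.
rewrite /qform big_ord_recl col0.
under eq_bigr => j _ do rewrite big_ord_recl mulrDl.
rewrite big_split /=.
have -> : \sum_i x ord0 * A ord0 (lift ord0 i) * x (lift ord0 i) = x ord0 * b.
  by rewrite mulr_sumr; apply: eq_bigr => i _; rewrite mulrA.
have [a0|a0] := eqVneq a 0; last by field.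
have -> : b = 0 by apply: big1 => j _; rewrite A0 // mul0r.
rewrite a0; ring.
Qed.

(** It suffices to test combinations of two basis vectors: with a zero corner the value is affine in
    the first coefficient, hence unbounded below unless [A ord0 j] is 0. *)
Lemma psd_corner n (A : 'I_n.+1 -> 'I_n.+1 -> rat) :
  (forall i j, A i j = A j i) -> (forall x, 0 <= qform A x) ->
  0 <= A ord0 ord0 /\ (A ord0 ord0 = 0 -> forall j, A ord0 j = 0).
Proof.
move=> symA psdA.
have form2 i (s t : rat) : qform A (fun k => s * (k == ord0)%:R + t * (k == i)%:R)
    = s ^+ 2 * A ord0 ord0 + s * t * A ord0 i *+ 2 + t ^+ 2 * A i i.
  have sumd (f : 'I_n.+1 -> rat) :
      \sum_k (s * (k == ord0)%:R + t * (k == i)%:R) * f k = s * f ord0 + t * f i.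
    under eq_bigr => k _ do rewrite mulrDl -!mulrA.
    rewrite big_split -!mulr_sumr /=; congr (_ * _ + _ * _).
      by rewrite (bigD1 ord0) // eqxx mul1r big1 /= ?addr0 // => k /negPf ->; rewrite mul0r.
    by rewrite (bigD1 i) // eqxx mul1r big1 /= ?addr0 // => k /negPf ->; rewrite mul0r.
  rewrite /qform; under eq_bigr => j _ do rewrite sumd mulrC.
  by rewrite sumd (symA i ord0); ring.
split; first by have := psdA (fun k => 1 * (k == ord0)%:R + 0 * (k == ord0)%:R); rewrite form2; lra.
move=> a0 j; apply/eqP; apply: contraT => nzb.
(* Chosen so that twice [s * A ord0 j], plus [A j j], equals -1. *)
pose s := - (A j j + 1) / (A ord0 j *+ 2).
have := psdA (fun k => s * (k == ord0)%:R + 1 * (k == j)%:R); rewrite form2 a0.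
have -> : s ^+ 2 * 0 + s * 1 * A ord0 j *+ 2 + 1 ^+ 2 * A j j = -1.
  by rewrite /s; field.
by [].
Qed.

(** Extending [x] by the first coordinate that annihilates the completed square makes the two forms
    agree. *)
Lemma psd_schur n (A : 'I_n.+1 -> 'I_n.+1 -> rat) :
  (forall i j, A i j = A j i) -> (forall x, 0 <= qform A x) ->
  forall x, 0 <= qform (schur A) x.
Proof.
move=> symA psdA x; have [_ A0] := psd_corner symA psdA.
pose b := \sum_j A ord0 (lift ord0 j) * x j.
pose y i := if unlift ord0 i is Some j then x j else - (A ord0 ord0)^-1 * b.
have yl j : y (lift ord0 j) = x j by rewrite /y liftK.
have := psdA y; rewrite qform_schur //.
under [in X in X ^+ 2]eq_bigr => j _ do rewrite yl.
have -> : qform (schur A) (fun j => y (lift ord0 j)) = qform (schur A) x.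
  by congr qform; apply/funext => j; rewrite yl.
by rewrite -/b /y unlift_none mulNr addNr expr0n mulr0 add0r.
Qed.

End QuadraticForms.

(** * Sums of squares in a field closed under square roots of [1 + x^2] *)

Section Pythagorean.
Variables (C : numFieldType) (S : C -> Prop).
Hypotheses (S1 : S 1) (SB : forall x y, S x -> S y -> S (x - y))
  (SM : forall x y, S x -> S y -> S (x * y)) (SV : forall x, S x -> x != 0 -> S x^-1)
  (Ssqrt : forall x, S x -> exists y, S y /\ y ^+ 2 = 1 + x ^+ 2).

Definition square_in x := exists y, S y /\ y ^+ 2 = x.

Lemma sub_closed0 : S 0. Proof. by rewrite -(subrr 1); apply: SB. Qed.
Lemma sub_closedN x : S x -> S (- x).
Proof. by move=> Sx; rewrite -sub0r; apply: SB => //; apply: sub_closed0. Qed.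
Lemma sub_closedD x y : S x -> S y -> S (x + y).
Proof. by move=> Sx Sy; rewrite -[y]opprK; apply: SB => //; apply: sub_closedN. Qed.
Lemma sub_closed_sum I (r : seq I) (P : pred I) (f : I -> C) :
  (forall i, P i -> S (f i)) -> S (\sum_(i <- r | P i) f i).
Proof. by move=> Sf; apply: big_ind => //; [apply: sub_closed0 | apply: sub_closedD]. Qed.
Lemma sub_closed_nat n : S n%:R.
Proof. by elim: n => [|n IHn]; [apply: sub_closed0 | rewrite -natr1; apply: sub_closedD]. Qed.
Lemma sub_closed_int (n : int) : S n%:~R.
Proof. by case: n => n; rewrite ?NegzE ?mulrNz; [|apply: sub_closedN]; apply: sub_closed_nat. Qed.
Lemma sub_closed_inv x : S x -> S x^-1.
Proof. by have [-> _|nzx Sx] := eqVneq x 0; [rewrite invr0; apply: sub_closed0 | apply: SV]. Qed.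
Lemma sub_closed_rat (a : rat) : S (ratr a).
Proof.
by rewrite /ratr; apply: SM; [|apply: sub_closed_inv]; apply: sub_closed_int.
Qed.
Lemma sub_closedX x n : S x -> S (x ^+ n).
Proof. by move=> Sx; elim: n => [|n IHn]; rewrite ?expr0 // exprS; apply: SM. Qed.

Lemma square_inM x y : square_in x -> square_in y -> square_in (x * y).
Proof. by move=> [u [Su <-]] [v [Sv <-]]; exists (u * v); split; [apply: SM | rewrite exprMn]. Qed.
Lemma square_in_sqr x : S x -> square_in (x ^+ 2).
Proof. by move=> Sx; exists x. Qed.
(** For nonzero [u], [u^2 + v^2 = u^2 (1 + (v/u)^2)], and the second factor has a root in [S]. *)
Lemma square_inD x y : square_in x -> square_in y -> square_in (x + y).
Proof.
move=> [u [Su <-]] [v [Sv <-]].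
have [->|nzu] := eqVneq u 0; first by rewrite expr0n add0r; exists v.
have [w [Sw w2]] := Ssqrt (SM Sv (SV Su nzu)).
by exists (u * w); split; [apply: SM | rewrite exprMn w2; field].
Qed.
Lemma square_in_nat n : square_in n%:R.
Proof.
elim: n => [|n IHn]; first by exists 0; split; [apply: sub_closed0 | rewrite expr0n].
by rewrite -natr1; apply: square_inD => //; exists 1; rewrite expr1n.
Qed.
Lemma square_in_rat (a : rat) : 0 <= a -> square_in (ratr a).
Proof.
rewrite -numq_ge0 /ratr; case: (numq a) => // n _.
have := denq_neq0 a; have := denq_gt0 a; case: (denq a) => // q _.
rewrite -(intr_eq0 C) => nzq.
(* Making the denominator a square leaves only natural numbers, which are sums of ones. *)
have -> : n%:~R / q%:~R = n%:R * q%:R * (q%:R)^-1 ^+ 2 :> C by field.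
apply: square_inM; first by apply: square_inM; apply: square_in_nat.
by apply: square_in_sqr; apply: sub_closed_inv; apply: sub_closed_nat.
Qed.

(** Induction through the Schur complement: each completed square contributes a nonnegative rational
    times a square of [S], and [square_inD] adds these up. *)
Lemma square_in_psd n (A : 'I_n -> 'I_n -> rat) (v : 'I_n -> C) :
  (forall i j, A i j = A j i) -> (forall x, 0 <= qform A x) -> (forall i, S (v i)) ->
  square_in (qform (fun i j => ratr (A i j)) v).
Proof.
elim: n A v => [|n IHn] A v symA psdA Sv.
  by rewrite /qform big_ord0; apply: (square_in_nat 0).
have [a_ge0 A0] := psd_corner symA psdA.
rewrite qform_schur => [|i j|]; last 2 first.
- by rewrite symA.
- by move=> /eqP; rewrite fmorph_eq0 => /eqP/A0 + j => ->; rewrite rmorph0.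
apply: square_inD.
  apply: square_inM; first exact: square_in_rat.
  apply: square_in_sqr; apply: sub_closedD => //.
  apply: SM; first by apply: sub_closed_inv; apply: sub_closed_rat.
  by apply: sub_closed_sum => j _; apply: SM => //; apply: sub_closed_rat.
have -> : schur (fun i j => ratr (A i j)) = fun i j => ratr (schur A i j) :> C.
  by apply/funext => i; apply/funext => j; rewrite /schur rmorphB !rmorphM fmorphV.
apply: IHn => // [i j|]; last exact: psd_schur.
by rewrite /schur symA; congr (_ - _); rewrite mulrAC.
Qed.

End Pythagorean.

(** * The trace form of a totally positive number *)

Section TraceForm.
Variable C : numClosedFieldType.
Variables (L : splittingFieldType rat) (iota : {rmorphism L -> C}).
Variable d : L.
Hypothesis d_pos : forall g : gal_of {:L}, 0 < iota (g d).
Local Notation n := (adjoin_degree 1 d).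
Local Notation powers y := (\col_(i < n) y ^+ i).

Let nz_d : d != 0.
Proof.
by have := d_pos 1%g; rewrite gal_id; apply: contraTneq => ->; rewrite rmorph0 ltxx.
Qed.

(** Each entry is the trace of [d ^+ i * d ^+ j / d], hence rational. *)
Lemma trace_form_exists : exists B : 'M[rat]_n, forall i j : 'I_n,
  (B i j)%:A = \sum_(g : gal_of {:L}) (g d) ^+ i * (g d) ^+ j / g d.
Proof.
have tr u : exists b : rat, b%:A == \sum_(g : gal_of {:L}) g u.
  have := mem_galTrace (galois_over_rat 1) (memvf u) => /vlineP[b Db]; exists b.
  rewrite -Db /galTrace; apply/eqP; apply: eq_bigl => g; exact: mem_gal_rat.
exists (\matrix_(i, j) xchoose (tr (d ^+ i * d ^+ j / d))) => i j.
rewrite mxE (eqP (xchooseP (tr _))); apply: eq_bigr => g _.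
by rewrite !rmorphM !rmorphXn fmorphV.
Qed.

Variable B : 'M[rat]_n.
Hypothesis BE : forall i j : 'I_n,
  (B i j)%:A = \sum_(g : gal_of {:L}) (g d) ^+ i * (g d) ^+ j / g d.

(** One rank-one summand per automorphism, so that products with [B] become evaluations at the
    conjugates of [d]. *)
Lemma trace_form_matrix : map_mx (in_alg L) B =
  \sum_(g : gal_of {:L}) (g d)^-1 *: (powers (g d) *m (powers (g d))^T).
Proof.
apply/matrixP => i j; rewrite mxE summxE [LHS]BE; apply: eq_bigr => g _.
by rewrite !mxE big_ord1 !mxE mulrC.
Qed.

Lemma trace_form_sym : B^T = B.
Proof.
apply/matrixP => i j; rewrite mxE; apply: (fmorph_inj (in_alg L)).
by rewrite /= !BE; apply: eq_bigr => g _; rewrite [X in X / _]mulrC.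
Qed.

Definition eval_row (x : 'rV[rat]_n) : L := \sum_i (x 0 i)%:A * d ^+ i.

Lemma eval_row_gal x (g : gal_of {:L}) : g (eval_row x) = \sum_i (x 0 i)%:A * (g d) ^+ i.
Proof.
rewrite rmorph_sum; apply: eq_bigr => i _; rewrite rmorphM rmorphXn.
by congr (_ * _); rewrite alg_num_field fmorph_rat.
Qed.

(** The row lists the coefficients of a polynomial of size at most [n], too small to be a nonzero
    multiple of the minimal polynomial of [d]. *)
Lemma eval_row_eq0 x : eval_row x = 0 -> x = 0.
Proof.
pose p := rVpoly (map_mx (in_alg L) x).
have -> : eval_row x = p.[d].
  rewrite (horner_coef_wide _ (size_poly _ _)); apply: eq_bigr => i _.
  by rewrite coef_rVpoly_ord mxE.
move=> pd; have p0 : p = 0.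
  apply/eqP; apply: contraT => nz_p.
  have : minPoly 1 d %| p.
    apply: minPoly_dvdp; last exact/rootP.
    apply/polyOverP => i; rewrite coef_rVpoly; case: insubP => [j _ _|_]; last exact: mem0v.
    by rewrite mxE memvZ ?mem1v.
  by move/(dvdp_leq nz_p); rewrite size_minPoly leqNgt ltnS size_poly.
have : map_mx (in_alg L) x = 0 by rewrite -[LHS]rVpolyK -/p p0 linear0.
by move/eqP; rewrite map_mx_eq0 => /eqP.
Qed.

Lemma trace_form_eval x : ((x *m B *m x^T) 0 0)%:A =
  \sum_(g : gal_of {:L}) (g (eval_row x)) ^+ 2 / g d.
Proof.
have -> : ((x *m B *m x^T) 0 0)%:A = (map_mx (in_alg L) (x *m B *m x^T)) 0 0.
  by rewrite [RHS]mxE.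
rewrite !map_mxM trace_form_matrix mulmx_sumr mulmx_suml summxE; apply: eq_bigr => g _.
rewrite -scalemxAr -scalemxAl mxE mulrC; congr (_ * _).
rewrite -map_trmx !mulmxA -(mulmxA (_ *m _)) -trmx_mul mxE big_ord1 [X in _ * X]mxE expr2.
have -> : (map_mx (in_alg L) x *m powers (g d)) 0 0 = g (eval_row x).
  by rewrite eval_row_gal mxE; apply: eq_bigr => i _; rewrite !mxE.
by [].
Qed.

(** Since [g d] is positive, a rational polynomial takes a real value there, and its square is
    nonnegative. *)
Lemma conj_eval_ge0 x (g : gal_of {:L}) : 0 <= iota ((g (eval_row x)) ^+ 2 / g d).
Proof.
rewrite rmorphM fmorphV mulr_ge0 ?invr_ge0 ?(ltW (d_pos _)) // rmorphXn.
apply: real_exprn_even_ge0 => //; rewrite eval_row_gal rmorph_sum.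
apply: rpred_sum => i _; rewrite rmorphM rmorphXn.
apply: rpredM; last by rewrite rpredX ?gtr0_real.
by rewrite /= alg_num_field fmorph_rat realE ler0q lerq0 le_total.
Qed.

Lemma trace_form_ge0 (x : 'rV_n) : 0 <= (x *m B *m x^T) 0 0.
Proof.
rewrite -(ler0q C) -(fmorph_rat iota) -alg_num_field trace_form_eval rmorph_sum.
by apply: sumr_ge0 => g _; apply: conj_eval_ge0.
Qed.

(** On a kernel vector a sum of nonnegative terms vanishes; its term at the identity makes the
    polynomial vanish at [d]. *)
Lemma trace_form_unit : B \in unitmx.
Proof.
rewrite unitmxE unitfE; apply/det0P => -[x nz_x xB0]; case/eqP: nz_x.
apply: eval_row_eq0; have : iota ((x *m B *m x^T) 0 0)%:A = 0.
  by rewrite xB0 mul0mx mxE scale0r rmorph0.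
rewrite trace_form_eval rmorph_sum => /eqP; rewrite psumr_eq0 => [|g _]; last exact: conj_eval_ge0.
move=> /allP/(_ 1%g); rewrite mem_index_enum fmorph_eq0 !gal_id => /(_ isT) /=.
by rewrite mulf_eq0 invr_eq0 (negPf nz_d) orbF expf_eq0 => /eqP.
Qed.

(** Evaluate the form of [B] at [x *m invmx B]. *)
Lemma inv_trace_form_ge0 (x : 'rV_n) : 0 <= (x *m invmx B *m x^T) 0 0.
Proof.
have := trace_form_ge0 (x *m invmx B).
rewrite trmx_mul trmx_inv trace_form_sym -[_ *m B]mulmxA mulVmx ?trace_form_unit //.
by rewrite mulmx1 mulmxA.
Qed.

(* Pair the form with the interpolating polynomial of d among its conjugates. *)
Lemma trace_form_reproduces : exists m : nat, d = m%:R *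
  ((powers d)^T *m map_mx (in_alg L) (invmx B) *m powers d) 0 0.
Proof.
(* [F] vanishes at every conjugate other than [d], but not at [d], by separability. *)
pose F := minPoly 1 d %/ ('X - d%:P).
have DF : minPoly 1 d = F * ('X - d%:P).
  by rewrite divpK // dvdp_XsubCl root_minPoly.
have sF : (size F <= n)%N.
  by rewrite size_divp ?polyXsubC_eq0 // size_XsubC size_minPoly subn1.
have Fd : F.[d] != 0.
  have : separable_poly (minPoly 1 d).
    by apply: pcharf0_separable; move=> k; rewrite pchar_lalg pchar_num.
  by rewrite DF separable_root => /andP[].
have Fg (g : gal_of {:L}) : g d != d -> F.[g d] = 0.
  move=> gd; have := root_minPoly_gal (sub1v _) (mem_gal_rat g) (memvf d).
  by rewrite DF rootM root_XsubC (negPf gd) orbF => /rootP.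
pose f : 'rV[L]_n := poly_rV F.
have fE y : (f *m powers y) 0 0 = F.[y].
  rewrite mxE (horner_coef_wide _ sF); apply: eq_bigr => i _.
  by rewrite !mxE.
have [u Du] : exists u, u = map_mx (in_alg L) (invmx B) *m powers d by eexists.
(* The value [d] occurs among the [g d] once for each automorphism fixing it. *)
exists #|[pred g : gal_of {:L} | g d == d]|; rewrite -mulmxA -Du.
(* This product is computed twice: directly it is [F.[d]], while expanding [B] over the
   automorphisms leaves only those fixing [d]. Cancelling [F.[d]] then gives the formula. *)
have : (f *m map_mx (in_alg L) B *m u) 0 0 = F.[d].
  by rewrite Du mulmxA -[f *m _ *m _]mulmxA -map_mxM mulmxV ?trace_form_unit // map_mx1 mulmx1 fE.
rewrite trace_form_matrix mulmx_sumr mulmx_suml summxE (bigID (fun g : gal_of {:L} => g d == d)) /=.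
rewrite [X in _ + X]big1 => [|g gd]; last first.
  by rewrite -scalemxAr -scalemxAl mxE !mulmxA -(mulmxA (_ *m _)) mxE big_ord1 fE Fg // mul0r mulr0.
rewrite addr0 (eq_bigr (fun=> d^-1 * (F.[d] * ((powers d)^T *m u) 0 0))) => [|g /eqP gd]; last first.
  by rewrite -scalemxAr -scalemxAl mxE !mulmxA -(mulmxA (_ *m _)) mxE big_ord1 fE gd.
rewrite sumr_const -mulr_natl => E.
apply: (mulfI Fd); rewrite -{1}E; field.
exact: nz_d.
Qed.

End TraceForm.

Lemma totally_positive_square (C : numClosedFieldType) (S : C -> Prop)
    (L : splittingFieldType rat) (iota : {rmorphism L -> C}) (d : L) : S 1 ->
  (forall x y, S x -> S y -> S (x - y)) -> (forall x y, S x -> S y -> S (x * y)) ->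
  (forall x, S x -> x != 0 -> S x^-1) ->
  (forall x, S x -> exists y, S y /\ y ^+ 2 = 1 + x ^+ 2) ->
  (forall g : gal_of {:L}, 0 < iota (g d)) -> S (iota d) -> square_in S (iota d).
Proof.
move=> S1 SB SM SV Ssqrt d_pos Sd; have [B BE] := trace_form_exists d.
have [m ->] := trace_form_reproduces d_pos BE.
rewrite rmorphM; apply: square_inM => //; first by rewrite rmorph_nat; apply: square_in_nat.
have -> : iota (((\col_i d ^+ i)^T *m map_mx (in_alg L) (invmx B) *m \col_i d ^+ i) 0 0) =
    qform (fun i j => ratr (invmx B i j)) (fun i => iota d ^+ i).
  rewrite mxE rmorph_sum; apply: eq_bigr => j _; rewrite rmorphM; congr (_ * _); last first.
    by rewrite mxE rmorphXn.
  rewrite mxE rmorph_sum; apply: eq_bigr => i _; rewrite rmorphM !mxE rmorphXn; congr (_ * _).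
  by rewrite -(fmorph_rat iota) -alg_num_field.
apply: square_in_psd => // [i j|x|i]; last exact: sub_closedX.
  by rewrite -{1}(trace_form_sym BE) -trmx_inv mxE.
have := inv_trace_form_ge0 d_pos BE (\row_i x i).
rewrite mxE (_ : \sum_j _ = qform (invmx B) x) //; apply: eq_bigr => j _; rewrite !mxE.
by congr (_ * _); apply: eq_bigr => i _; rewrite mxE.
Qed.

(** * Totally real and constructible numbers *)

Section Closure.
Variable C : numClosedFieldType.
Notation QtoC := (ratr : rat -> C).
Implicit Types (x y z : C) (s : seq C).

Lemma sqr_ge0_real y : 0 <= y ^+ 2 -> y \is Num.real.
Proof.
move=> y2; have : y ^+ 2 == sqrtC (y ^+ 2) ^+ 2 by rewrite sqrtCK.
by rewrite eqf_sqr => /orP[] /eqP ->; rewrite ?realN ger0_real ?sqrtC_ge0.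
Qed.

Lemma conj_real_algebraic z : conj_real z -> algebraicOver QtoC z.
Proof. by move=> [p [mon_p pz _ _]]; exists p; rewrite ?monic_neq0. Qed.

Lemma conj_real1 : conj_real (1 : C).
Proof.
have [//|L [iota _]] := @number_field_exists C [::].
rewrite -(rmorph1 iota); apply/conj_realP => g.
by rewrite !rmorph1 real1.
Qed.

(** Inside a number field containing both, the claim is checked on the images under each
    automorphism; the other field operations go alike. *)
Lemma conj_realB x y : conj_real x -> conj_real y -> conj_real (x - y).
Proof.
move=> rx ry; have [z|L [iota sL]] := @number_field_exists C [:: x; y].
  by rewrite !inE => /orP[] /eqP ->; apply: conj_real_algebraic.
have [u Du] := sL x (mem_head _ _); have [|v Dv] := sL y; first by rewrite !inE eqxx orbT.
rewrite -{}Du -{}Dv in rx ry *; rewrite -rmorphB; apply/conj_realP => g.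
by rewrite !rmorphB rpredB //; [apply/conj_realP: g | apply/conj_realP: g].
Qed.

Lemma conj_realM x y : conj_real x -> conj_real y -> conj_real (x * y).
Proof.
move=> rx ry; have [z|L [iota sL]] := @number_field_exists C [:: x; y].
  by rewrite !inE => /orP[] /eqP ->; apply: conj_real_algebraic.
have [u Du] := sL x (mem_head _ _); have [|v Dv] := sL y; first by rewrite !inE eqxx orbT.
rewrite -{}Du -{}Dv in rx ry *; rewrite -rmorphM; apply/conj_realP => g.
by rewrite !rmorphM rpredM //; [apply/conj_realP: g | apply/conj_realP: g].
Qed.

Lemma conj_realV x : conj_real x -> conj_real x^-1.
Proof.
move=> rx; have [z|L [iota sL]] := @number_field_exists C [:: x].
  by rewrite inE => /eqP ->; apply: conj_real_algebraic.
have [u Du] := sL x (mem_head _ _); rewrite -{}Du in rx *.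
by rewrite -fmorphV; apply/conj_realP => g; rewrite !fmorphV rpredV; apply/conj_realP: g.
Qed.

(** Every conjugate of [y] squares to 1 plus the square of a real number. *)
Lemma conj_real_sqrt1x2 x y : conj_real x -> y ^+ 2 = 1 + x ^+ 2 -> conj_real y.
Proof.
move=> rx y2; have algx := conj_real_algebraic rx.
have algy : algebraicOver QtoC y.
  apply: algebraic_sqrt y2 _; apply: algebraic_add; first exact: algebraic1.
  by rewrite expr2; apply: algebraic_mul.
have [z|L [iota sL]] := @number_field_exists C [:: x; y].
  by rewrite !inE => /orP[] /eqP ->.
have [u Du] := sL x (mem_head _ _); have [|v Dv] := sL y; first by rewrite !inE eqxx orbT.
rewrite -{}Du -{}Dv in rx y2 *; apply/conj_realP => g; apply: sqr_ge0_real.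
have {}y2 : v ^+ 2 = 1 + u ^+ 2.
  by apply: (fmorph_inj iota); rewrite rmorphD !rmorphXn rmorph1.
rewrite -!rmorphXn y2 !rmorphD !rmorph1 !rmorphXn addr_ge0 //.
by apply: real_exprn_even_ge0 => //; apply/conj_realP: g.
Qed.

Definition fixed_by_odd (L : splittingFieldType rat) (u : L) :=
  forall g : gal_of {:L}, (2%N^'.-elt g)%g -> g u = u.

(** An automorphism fixing [u ^+ 2] sends [u] to [u] or [- u]; in the second case, raising it to its
    odd order gives [u = - u]. *)
Lemma fixed_by_odd_sqrt (L : splittingFieldType rat) (u : L) :
  fixed_by_odd (u ^+ 2) -> fixed_by_odd u.
Proof.
move=> fix_u2 g odd_g; have := fix_u2 g odd_g; rewrite rmorphXn => /eqP.
rewrite eqf_sqr => /orP[/eqP //|/eqP gu].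
have gk k : (g ^+ k)%g u = (-1) ^+ k * u.
  elim: k => [|k IHk]; first by rewrite expg0 gal_id mul1r.
  by rewrite expgSr galM ?memvf // IHk rmorphM rmorphXn rmorphN rmorph1 gu exprSr; ring.
have := gk #[g]%g; rewrite expg_order gal_id -signr_odd.
have -> : odd #[g]%g by rewrite -[odd _]negbK -dvdn2 -p'natE.
by rewrite expr1 mulN1r => uN; rewrite gu -uN.
Qed.

(* Iterated square roots are only needed through their being fixed by automorphisms of
   odd order of every normal number field that contains the roots extracted on the way. *)
Definition constructible z := algebraicOver QtoC z /\
  exists2 s : seq C, (forall x, x \in s -> algebraicOver QtoC x) &
  forall (L : splittingFieldType rat) (iota : {rmorphism L -> C}),
    (forall x, x \in s -> exists u, iota u = x) -> exists2 u, iota u = z & fixed_by_odd u.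

Lemma constructible1 : constructible 1.
Proof.
split; first exact: algebraic1.
by exists [::] => // L iota _; exists 1 => [|g _]; rewrite rmorph1.
Qed.

Lemma constructibleB x y : constructible x -> constructible y -> constructible (x - y).
Proof.
move=> [algx [s algs sx]] [algy [t algt ty]]; split; first exact: algebraic_sub.
exists (s ++ t) => [z|L iota sL]; first by rewrite mem_cat => /orP[/algs|/algt].
have [|u <- fix_u] := sx L iota; first by move=> z sz; apply: sL; rewrite mem_cat sz.
have [|v <- fix_v] := ty L iota; first by move=> z tz; apply: sL; rewrite mem_cat tz orbT.
by exists (u - v) => [|g odd_g]; rewrite rmorphB //= (fix_u _ odd_g) (fix_v _ odd_g).
Qed.

Lemma constructibleM x y : constructible x -> constructible y -> constructible (x * y).
Proof.
move=> [algx [s algs sx]] [algy [t algt ty]]; split; first exact: algebraic_mul.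
exists (s ++ t) => [z|L iota sL]; first by rewrite mem_cat => /orP[/algs|/algt].
have [|u <- fix_u] := sx L iota; first by move=> z sz; apply: sL; rewrite mem_cat sz.
have [|v <- fix_v] := ty L iota; first by move=> z tz; apply: sL; rewrite mem_cat tz orbT.
by exists (u * v) => [|g odd_g]; rewrite rmorphM //= (fix_u _ odd_g) (fix_v _ odd_g).
Qed.

Lemma constructibleV x : constructible x -> constructible x^-1.
Proof.
move=> [algx [s algs sx]]; split; first exact: algebraic_inv.
exists s => // L iota /sx[u <- fix_u].
by exists u^-1 => [|g odd_g]; rewrite fmorphV //= (fix_u _ odd_g).
Qed.

Lemma constructible_sqrt x y : y ^+ 2 = x -> constructible x -> constructible y.
Proof.
move=> y2 [algx [s algs sx]]; have algy := algebraic_sqrt y2 algx; split=> //.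
exists (y :: s) => [z|L iota sL]; first by rewrite inE => /predU1P[->|/algs].
have [v Dv] := sL y (mem_head _ _); exists v => //; apply: fixed_by_odd_sqrt.
have [|u Du fix_u] := sx L iota; first by move=> z sz; apply: sL; rewrite inE sz orbT.
suffices -> : v ^+ 2 = u by [].
by apply: (fmorph_inj iota); rewrite rmorphXn /= Dv y2.
Qed.

End Closure.

(** * Climbing the totally real field by quadratic steps *)

Section OneStep.

(** The quotient [H / N] is a nontrivial 2-group, so a maximal proper subgroup of it is normal of
    index 2; pull it back to [H]. *)
Lemma index2_over_odd (gT : finGroupType) (N H : {group gT}) : (N <| H)%g -> ~~ (H \subset N) ->
  (forall h, h \in H -> (2%N^'.-elt h)%g -> h \in N) ->
  exists2 M : {group gT}, (N \subset M) && ((M <| H)%g) & #|H : M|%g = 2%N.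
Proof.
move=> nNH nsHN oddN; have [sNH nNHs] := andP nNH.
have pHN : (2%N.-group (H / N))%g.
  apply/pgroupP => q pr_q qHN; have [X HX oX] := Cauchy pr_q qHN.
  have [x Nx Hx DX] := morphimP HX.
  (* The odd part of [x] dies in the quotient, so [X] is the image of a 2-element. *)
  have x'N : (x.`_(2%N^'))%g \in N by apply: oddN; rewrite ?groupX ?p_elt_constt.
  have : (2%N.-elt X)%g.
    rewrite DX -(consttC 2%N x) morphM ?groupX //= (coset_id x'N) mulg1.
    by apply: morph_p_elt; rewrite ?groupX ?p_elt_constt.
  by rewrite /p_elt oX pnatE.
have ntHN : (1 != H / N)%g.
  by apply: contraNneq nsHN => E1; rewrite -quotient_sub1 // -E1.
have [/eqP|[Mb maxMb _]] := maximal_exists (sub1G (H / N)%G); first by rewrite (negPf ntHN).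
have iMb := p_maximal_index pHN maxMb; have nMb := p_maximal_normal pHN maxMb.
have [M DM sNM nMH] := inv_quotientN nNH nMb.
exists M; first by rewrite sNM.
have nNM : (N <| M)%g by apply: normalS sNM (normal_sub nMH) nNH.
rewrite -iMb DM index_quotient_eq // ?(normal_sub nMH) //.
by rewrite finset.subIset ?sNM ?orbT.
Qed.

(** Choose a subspace of largest dimension inside [P]: adding the line of any element of [P] stays
    inside [P], so the subspace is already all of [P]. *)
Lemma subfield_of_pred (F : fieldType) (L : fieldExtType F) (P : L -> Prop) : P 1 ->
  (forall x y, P x -> P y -> P (x - y)) -> (forall x y, P x -> P y -> P (x * y)) ->
  (forall a x, P x -> P (a *: x)) ->
  exists K : {subfield L}, forall x, x \in K <-> P x.
Proof.
move=> P1 PB PM PZ.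
have P0 : P 0 by rewrite -(subrr 1); apply: PB.
have PD x y : P x -> P y -> P (x + y).
  by move=> Px Py; rewrite -[y]opprK; apply: (PB) => //; rewrite -sub0r; apply: PB.
pose inP n := `[< exists2 U : {vspace L}, forall x, x \in U -> P x & \dim U = n >].
have ex0 : exists n, inP n.
  by exists 0%N; apply/asboolP; exists 0%VS; rewrite ?dimv0 // => x; rewrite memv0 => /eqP ->.
have bnd n : inP n -> (n <= \dim {:L})%N by move=> /asboolP[U _ <-]; rewrite dimvS ?subvf.
case: (ex_maxnP ex0 bnd) => n /asboolP[U UP dimU] max_n.
have PU x : P x -> x \in U.
  move=> Px; have : inP (\dim (U + <[x]>)%VS).
    apply/asboolP; exists (U + <[x]>)%VS => // y /memv_addP[u /UP Pu [v /vlineP[a ->] ->]].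
    by apply: PD => //; apply: PZ.
  move/max_n; rewrite -dimU => le_dim.
  have /eqP -> : (U == U + <[x]>)%VS by rewrite -dimv_leqif_eq ?addvSl //
    eqn_leq le_dim dimvS ?addvSl.
  by rewrite (subvP (addvSr _ _)) ?memv_line.
have asp : is_aspace U.
  apply/andP; split; first by apply: has_algid1; apply: PU.
  by apply/prodvP => x y Ux Uy; apply: PU; apply: PM; apply: UP.
by exists (ASpace asp) => x; split=> [/UP|/PU].
Qed.

Variables (C : numClosedFieldType) (S : C -> Prop).
Hypotheses (S1 : S 1) (SB : forall x y, S x -> S y -> S (x - y))
  (SM : forall x y, S x -> S y -> S (x * y)) (SV : forall x, S x -> x != 0 -> S x^-1)
  (Ssqrt : forall x, S x -> exists y, S y /\ y ^+ 2 = 1 + x ^+ 2).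
Variables (L : splittingFieldType rat) (iota : {rmorphism L -> C}).
Implicit Types (u : L) (g : gal_of {:L}).

Definition real_odd u := (forall g, iota (g u) \is Num.real) /\ fixed_by_odd u.

Lemma real_odd_field : exists E : {subfield L}, forall u, u \in E <-> real_odd u.
Proof.
apply: subfield_of_pred.
- by split=> g; rewrite !rmorph1 ?real1.
- move=> x y [rx ox] [ry oy]; split=> g; first by rewrite !rmorphB /= rpredB.
  by move=> odd_g; rewrite rmorphB /= (ox _ odd_g) (oy _ odd_g).
- move=> x y [rx ox] [ry oy]; split=> g; first by rewrite !rmorphM /= rpredM.
  by move=> odd_g; rewrite rmorphM /= (ox _ odd_g) (oy _ odd_g).
- move=> a x [rx ox]; split=> g; last by move=> odd_g; rewrite linearZ /= (ox _ odd_g).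
  by rewrite linearZ /= rmorphZ_num rpredM // realE ler0q lerq0 le_total.
Qed.

(** Conjugate automorphisms have the same order. This stability makes [E] normal over the
    rationals. *)
Lemma real_odd_gal u g : real_odd u -> real_odd (g u).
Proof.
move=> [ru ou]; split=> h; first by rewrite -galM ?memvf.
move=> odd_h; have := ou (h ^ g^-1)%g; rewrite p_eltJ => /(_ odd_h).
rewrite conjgE invgK !galM ?memvf // => /(congr1 g).
by rewrite -[g (_ (h (g u)))]galM ?memvf // mulVg gal_id.
Qed.

Lemma gal_sub_fixed (K : {subfield L}) g : reflect {in K, forall u, g u = u} (g \in 'Gal({:L} / K)%g).
Proof. by rewrite gal_kHom ?subvf //; apply: kAHomP. Qed.

(** If [K] were smaller, an index 2 subgroup [M] of [Gal(L/K)] containing [Gal(L/E)] would give an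
    element of [E] outside [K] whose square is a totally positive element of [K]. Its root lies in
    [S], hence in [K]. *)
Lemma one_step (E K : {subfield L}) : (forall u, u \in E <-> real_odd u) ->
  (forall u, u \in K <-> u \in E /\ S (iota u)) -> (E <= K)%VS.
Proof.
move=> EP KP; apply: contraT => nsEK.
have sKE : (K <= E)%VS by apply/subvP => u /KP[].
pose N := 'Gal({:L} / E)%G; pose H := 'Gal({:L} / K)%G.
have sNH : N \subset H by apply: galS.
have fixH u : (forall h, h \in H -> h u = u) -> u \in K.
  move=> fix_u; have /galois_fixedField <- := galois_over_rat K.
  by apply/fixedFieldP; rewrite ?memvf.
have fixN u : (forall h, h \in N -> h u = u) -> u \in E.
  move=> fix_u; have /galois_fixedField <- := galois_over_rat E.
  by apply/fixedFieldP; rewrite ?memvf.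
have nNH : (N <| H)%g.
  rewrite /normal sNH /=; apply/fintype.subsetP => g _; rewrite inE gal_conjg.
  suffices -> : (g @: E)%VS = E by [].
  apply/eqP; rewrite -dimv_leqif_eq; last first.
    by apply/subvP => _ /memv_imgP[u /EP Eu ->]; apply/EP; apply: real_odd_gal.
  by rewrite limg_dim_eq // (eqP (AEnd_lker0 _)) capv0.
have nsHN : ~~ (H \subset N).
  apply: contra nsEK => sHN; apply/subvP => u Eu; apply: fixH => h /(fintype.subsetP sHN).
  by move/gal_sub_fixed; apply.
have oddN h : h \in H -> (2%N^'.-elt h)%g -> h \in N.
  by move=> _ odd_h; apply/gal_sub_fixed => u /EP[_]; apply.
have [M /andP[sNM nMH] iM] := index2_over_odd nNH nsHN oddN.
have [sMH _] := andP nMH.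
have /subvPn[x Mx nKx] : ~~ (fixedField M <= K)%VS.
  apply/negP => /(galS {:L}); rewrite gal_fixedField => sHM.
  have iM1 : #|H : M|%g == 1%N by rewrite indexg_eq1.
  by rewrite iM in iM1.
have [_ fixMx] := mem_fixedFieldP Mx.
have /fintype.subsetPn[g Hg nMg] : ~~ (H \subset M) by rewrite -indexg_eq1 iM.
have HM h : h \in H -> h \notin M -> exists2 m, m \in M & h = (m * g)%g.
  move=> Hh nMh; have /rcosetP : h \in (M :* g)%g.
    by rewrite (rcoset_index2 sMH iM) inE ?nMg ?nMh.
  by case=> m Mm ->; exists m.
have ggx : g (g x) = x.
  rewrite -galM ?memvf //; apply: fixMx; apply: contraT => /HM[|m Mm]; first by rewrite groupM.
  by move/mulIg => gm; rewrite gm Mm in nMg.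
have mgx m : m \in M -> m (g x) = g x.
  move=> Mm; have Mmg : (m ^ g^-1)%g \in M by rewrite memJ_norm // groupV (fintype.subsetP (normal_norm nMH)).
  rewrite -galM ?memvf //.
  have -> : (g * m = m ^ g^-1 * g)%g by rewrite conjgE invgK -!mulgA mulVg mulg1.
  by rewrite galM ?memvf // fixMx.
(* The part of [x] that [g] negates: [M] fixes [y] and the other coset changes its sign, so [y ^+ 2]
   is fixed by [H]. *)
pose y := x - g x.
have gy : g y = - y by rewrite rmorphB /= ggx opprB.
have my m : m \in M -> m y = y by move=> Mm; rewrite rmorphB /= fixMx ?mgx.
have nz_y : y != 0.
  apply: contraNneq nKx => /eqP; rewrite subr_eq0 => /eqP xg; apply: fixH => h Hh.
  case: (boolP (h \in M)) => [/fixMx //|/(HM h Hh)[m Mm ->]].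
  by rewrite galM ?memvf // fixMx // -xg.
have Ey : y \in E by apply: fixN => h /(fintype.subsetP sNM); apply: my.
have nKy : y \notin K.
  apply/negP => Ky; have /gal_sub_fixed/(_ y Ky) := Hg; rewrite gy => /(congr1 iota)/eqP.
  by rewrite rmorphN -subr_eq0 -opprD oppr_eq0 -mulr2n mulrn_eq0 /= fmorph_eq0 (negPf nz_y).
have Kd : y ^+ 2 \in K.
  apply: fixH => h Hh; rewrite rmorphXn /=.
  case: (boolP (h \in M)) => [/my -> //|/(HM h Hh)[m Mm ->]].
  by rewrite galM ?memvf // my // gy sqrrN.
have [ry _] := (EP y).1 Ey; have [_ Sd] := (KP _).1 Kd.
have pos_d (h : gal_of {:L}) : 0 < iota (h (y ^+ 2)).
  by rewrite rmorphXn /= rmorphXn real_exprn_even_gt0 //= !fmorph_eq0.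
have [w [Sw]] := totally_positive_square S1 SB SM SV Ssqrt pos_d Sd.
rewrite rmorphXn => /eqP; rewrite eqf_sqr => /orP[] /eqP Dw; case/negP: nKy; apply/KP; split=> //.
  by rewrite -Dw.
by rewrite -[iota y]opprK -Dw; apply: sub_closedN.
Qed.

Lemma real_odd_in u : real_odd u -> S (iota u).
Proof.
have [E EP] := real_odd_field => /EP Eu.
have [||||K KP] := @subfield_of_pred _ L (fun u => u \in E /\ S (iota u)).
- by rewrite mem1v rmorph1.
- by move=> x y [Ex Sx] [Ey Sy]; rewrite rpredB // rmorphB; split=> //; apply: SB.
- by move=> x y [Ex Sx] [Ey Sy]; rewrite rpredM // rmorphM; split=> //; apply: SM.
- move=> a x [Ex Sx]; rewrite memvZ // rmorphZ_num; split=> //; apply: SM => //.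
  exact: sub_closed_rat.
by have /subvP/(_ u Eu)/KP[] := one_step EP KP.
Qed.

End OneStep.

Theorem constructible_conj_real_in (C : numClosedFieldType) (S : C -> Prop) z : S 1 ->
  (forall x y, S x -> S y -> S (x - y)) -> (forall x y, S x -> S y -> S (x * y)) ->
  (forall x, S x -> x != 0 -> S x^-1) ->
  (forall x, S x -> exists y, S y /\ y ^+ 2 = 1 + x ^+ 2) ->
  constructible z -> conj_real z -> S z.
Proof.
move=> S1 SB SM SV Ssqrt [_ [s algs sz]] real_z.
have [L [iota sL]] := number_field_exists algs.
have [u Du fix_u] := sz L iota sL; rewrite -{}Du in real_z *.
by apply: real_odd_in => //; split=> //; apply/conj_realP.
Qed.

(** * Lines and reflections *)

Section Lines.
Variable R : realType.
Implicit Types (a b c : R) (p q r : Defs.point R).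

Definition Line a b c : Defs.point R -> Prop := fun p => a * p.1 + b * p.2 = c.

(** Lines with the same points become equal, so that membership in a collection of lines can be
    rewritten. *)
Lemma pred_ext (l l' : Defs.point R -> Prop) : (forall p, l p <-> l' p) -> l = l'.
Proof. by move=> H; apply/funext => p; apply/propext. Qed.

Lemma norm_gt0 a b : a != 0 \/ b != 0 -> 0 < a ^+ 2 + b ^+ 2.
Proof.
case=> nz; first by rewrite ltr_pwDl ?sqr_ge0 // exprn_even_gt0.
by rewrite ltr_wpDl ?sqr_ge0 // exprn_even_gt0.
Qed.

Lemma norm_neq0 a b : a ^+ 2 + b ^+ 2 != 0 -> a != 0 \/ b != 0.
Proof.
have [->|] := eqVneq a 0; last by left.
by have [->|] := eqVneq b 0; [rewrite expr0n addr0 eqxx | right].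
Qed.

Lemma Line_scale k a b c : k != 0 -> Line (k * a) (k * b) (k * c) = Line a b c.
Proof.
move=> nzk; apply: pred_ext => p; rewrite /Line -!mulrA -mulrDr.
by split=> [/(mulfI nzk)|->].
Qed.

Lemma is_line_Line a b c : a != 0 \/ b != 0 -> is_line (Line a b c).
Proof. by move=> nz; exists a, b, c. Qed.

Definition foot a b c r : Defs.point R :=
  let t := (c - (a * r.1 + b * r.2)) / (a ^+ 2 + b ^+ 2) in (r.1 + t * a, r.2 + t * b).

Lemma foot_on a b c r : a != 0 \/ b != 0 -> Line a b c (foot a b c r).
Proof. by move=> /norm_gt0/lt0r_neq0 nz; rewrite /Line /foot /=; field. Qed.

Lemma sqdist_foot a b c r : a != 0 \/ b != 0 ->
  sqdist r (foot a b c r) = (a * r.1 + b * r.2 - c) ^+ 2 / (a ^+ 2 + b ^+ 2).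
Proof. by move=> /norm_gt0/lt0r_neq0 nz; rewrite /sqdist /foot /=; field. Qed.

(** Cauchy-Schwarz: the defect is the squared determinant of the normal and [r - p]. *)
Lemma sqdist_line_ge a b c r p : a != 0 \/ b != 0 -> Line a b c p ->
  (a * r.1 + b * r.2 - c) ^+ 2 / (a ^+ 2 + b ^+ 2) <= sqdist r p.
Proof.
move=> nz <-; rewrite ler_pdivrMr ?norm_gt0 // /sqdist -subr_ge0.
have -> : ((r.1 - p.1) ^+ 2 + (r.2 - p.2) ^+ 2) * (a ^+ 2 + b ^+ 2)
   - (a * r.1 + b * r.2 - (a * p.1 + b * p.2)) ^+ 2 =
   (a * (r.2 - p.2) - b * (r.1 - p.1)) ^+ 2 by ring.
exact: sqr_ge0.
Qed.

(** Feet of perpendiculars attain the distances, and normals of equal length cancel the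
    denominators. *)
Lemma equidistant_Line (M : Defs.point R -> Prop) a b c a' b' c' :
  a != 0 \/ b != 0 -> a' ^+ 2 + b' ^+ 2 = a ^+ 2 + b ^+ 2 ->
  equidistant M (Line a b c) (Line a' b' c') <->
  forall r, M r -> (a * r.1 + b * r.2 - c) ^+ 2 = (a' * r.1 + b' * r.2 - c') ^+ 2.
Proof.
move=> nz eqn; have n_gt0 := norm_gt0 nz.
have nz' : a' != 0 \/ b' != 0 by apply: norm_neq0; rewrite eqn lt0r_neq0.
split=> [eqd r /eqd[d12 d21]|eqd r /eqd E].
  have [p2 [L2p le2]] := d12 _ (foot_on c r nz); have [p1 [L1p le1]] := d21 _ (foot_on c' r nz').
  have := le_trans (sqdist_line_ge r nz L1p) le1; have := le_trans (sqdist_line_ge r nz' L2p) le2.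
  rewrite !sqdist_foot // eqn !ler_pM2r ?invr_gt0 // => h1 h2.
  by apply/eqP; rewrite eq_le h1 h2.
split=> [p L1p|p L2p].
  exists (foot a' b' c' r); split; first exact: foot_on.
  by rewrite sqdist_foot // eqn -E sqdist_line_ge.
exists (foot a b c r); split; first exact: foot_on.
by rewrite sqdist_foot // E -eqn sqdist_line_ge.
Qed.

Definition reflect_pt a b c r : Defs.point R :=
  let t := 2 * (c - (a * r.1 + b * r.2)) / (a ^+ 2 + b ^+ 2) in (r.1 + t * a, r.2 + t * b).

Lemma reflect_ptK a b c r : a != 0 \/ b != 0 -> reflect_pt a b c (reflect_pt a b c r) = r.
Proof.
by move=> /norm_gt0/lt0r_neq0 nz; case: r => x y; rewrite /reflect_pt /=; congr (_, _); field.
Qed.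

Lemma perp_bisectorE p q : perp_bisector p q =
  Line (2 * (q.1 - p.1)) (2 * (q.2 - p.2)) (q.1 ^+ 2 + q.2 ^+ 2 - p.1 ^+ 2 - p.2 ^+ 2).
Proof. by apply: pred_ext => r; rewrite /perp_bisector /Line /sqdist; split=> E; lra. Qed.

(** Two points of the line on the bisector force [r'] to differ from [r] by a multiple [t] of the
    normal; equidistance of one of them then determines the nonzero [t]. *)
Lemma mirror_Line a b c r r' : a != 0 \/ b != 0 ->
  mirror (Line a b c) r r' <-> r' = reflect_pt a b c r.
Proof.
move=> nz; have nzn := lt0r_neq0 (norm_gt0 nz); split.
  case=> [[Lr ->]|[neq bis]].
    by rewrite /reflect_pt Lr subrr mulr0 mul0r !mul0r !addr0; case: r {Lr}.
  have [f Lf] : exists f, Line a b c f by exists (foot a b c r); exact: foot_on.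
  have Lg : Line a b c (f.1 - b, f.2 + a) by move: Lf; rewrite /Line /=; lra.
  have := (bis f).1 Lf; have := (bis _).1 Lg; rewrite perp_bisectorE /Line /= => E2 E1.
  move: Lf; rewrite /Line => Lf; move: f.1 f.2 E1 E2 Lf {Lg} => f1 f2 E1 E2 Lf.
  have perp : a * (r'.2 - r.2) = b * (r'.1 - r.1) by lra.
  pose t := (a * (r'.1 - r.1) + b * (r'.2 - r.2)) / (a ^+ 2 + b ^+ 2).
  have D1 : r'.1 = r.1 + t * a.
    apply/eqP; rewrite -subr_eq0; apply/eqP.
    have -> : r'.1 - (r.1 + t * a) = - b * (a * (r'.2 - r.2) - b * (r'.1 - r.1)) / (a ^+ 2 + b ^+ 2).
      by rewrite /t; field.
    by rewrite perp subrr mulr0 mul0r.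
  have D2 : r'.2 = r.2 + t * b.
    apply/eqP; rewrite -subr_eq0; apply/eqP.
    have -> : r'.2 - (r.2 + t * b) = a * (a * (r'.2 - r.2) - b * (r'.1 - r.1)) / (a ^+ 2 + b ^+ 2).
      by rewrite /t; field.
    by rewrite perp subrr mulr0 mul0r.
  have nzt : t != 0.
    apply/eqP => t0; apply: neq; rewrite [r]surjective_pairing [r']surjective_pairing.
    by rewrite D1 D2 t0 !mul0r !addr0.
  have tE : t * (2 * (c - (a * r.1 + b * r.2)) - t * (a ^+ 2 + b ^+ 2)) = 0.
    by move: E1; rewrite D1 D2 -Lf => /eqP; rewrite -subr_eq0 => /eqP <-; ring.
  move/eqP: tE; rewrite mulf_eq0 (negPf nzt) subr_eq0 => /eqP tE.
  rewrite [r']surjective_pairing D1 D2 /reflect_pt tE.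
  by rewrite mulfK.
move=> ->; set k := c - (a * r.1 + b * r.2).
have [k0|nzk] := eqVneq k 0.
  left; split; first by rewrite /Line; move: k0; rewrite /k => k0; lra.
  by rewrite /reflect_pt -/k k0 mulr0 !mul0r !addr0; case: r {k k0}.
right; pose t := 2 * k / (a ^+ 2 + b ^+ 2).
have nzt : t != 0 by rewrite !mulf_neq0 ?invr_neq0 ?pnatr_eq0.
rewrite /reflect_pt -/k -/t; split=> [E|x].
  have [E1 E2] : t * a = 0 /\ t * b = 0.
    by move: (congr1 fst E) (congr1 snd E) => /= E1 E2; split; lra.
  have : t * (a ^+ 2 + b ^+ 2) = 0 by rewrite mulrDr !expr2 !mulrA E1 E2 !mul0r addr0.
  by move/eqP; rewrite mulf_eq0 (negPf nzt) (negPf nzn).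
rewrite perp_bisectorE /Line /=.
have tn : t * (a ^+ 2 + b ^+ 2) = 2 * k by rewrite /t divfK. clearbody t.
have E : 2 * (r.1 + t * a - r.1) * x.1 + 2 * (r.2 + t * b - r.2) * x.2 -
    ((r.1 + t * a) ^+ 2 + (r.2 + t * b) ^+ 2 - r.1 ^+ 2 - r.2 ^+ 2) =
    2 * t * (a * x.1 + b * x.2 - c).
  have -> : c = k + (a * r.1 + b * r.2) by rewrite /k; ring.
  have -> : 2 * t * (a * x.1 + b * x.2 - (k + (a * r.1 + b * r.2))) =
    2 * t * (a * x.1 + b * x.2 - (a * r.1 + b * r.2)) - t * (2 * k) by ring.
  by rewrite -tn; ring.
split=> H; first by apply/eqP; rewrite -subr_eq0 E H subrr mulr0.
move/eqP: H; rewrite -subr_eq0 E !mulf_eq0 (negPf nzt) pnatr_eq0 /= subr_eq0.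
by move/eqP.
Qed.

(** Reflection is an involution, so the image line is a preimage: substitute the formula and clear
    [n]. *)
Lemma reflect_Line a b c a' b' c' : a != 0 \/ b != 0 ->
  let n := a ^+ 2 + b ^+ 2 in let k := 2 * (a * a' + b * b') in
  reflect_line (Line a b c) (Line a' b' c') =
  Line (n * a' - k * a) (n * b' - k * b) (n * c' - k * c).
Proof.
move=> nz n k; have nzn : n != 0 := lt0r_neq0 (norm_gt0 nz).
have on q : Line a' b' c' (reflect_pt a b c q) <->
    Line (n * a' - k * a) (n * b' - k * b) (n * c' - k * c) q.
  rewrite -(Line_scale _ _ _ nzn) /Line /reflect_pt /= -/n.
  have -> : n * a' * (q.1 + 2 * (c - (a * q.1 + b * q.2)) / n * a) +
     n * b' * (q.2 + 2 * (c - (a * q.1 + b * q.2)) / n * b) =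
     (n * a' - k * a) * q.1 + (n * b' - k * b) * q.2 + k * c by rewrite /k; field.
  by split=> E; lra.
apply: pred_ext => q; rewrite -on; split=> [[r [Lr /(mirror_Line _ _ _ nz) ->]]|Lq].
  by rewrite reflect_ptK.
exists (reflect_pt a b c q); split=> //; apply/mirror_Line => //.
by rewrite reflect_ptK.
Qed.

Lemma line_throughE p q : line_through p q =
  Line (q.2 - p.2) (p.1 - q.1) ((q.2 - p.2) * p.1 - (q.1 - p.1) * p.2).
Proof. by apply: pred_ext => r; rewrite /line_through /Line; split=> E; lra. Qed.

Lemma pair_neq p q : p <> q -> q.1 - p.1 != 0 \/ q.2 - p.2 != 0.
Proof.
move=> neq; rewrite !subr_eq0; have [E1|] := eqVneq q.1 p.1; last by left.
have [E2|] := eqVneq q.2 p.2; last by right.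
by case: neq; rewrite [p]surjective_pairing [q]surjective_pairing E1 E2.
Qed.

Lemma Line_eq a b c a' b' c' r : a != 0 \/ b != 0 -> a' != 0 \/ b' != 0 ->
  a * b' = a' * b -> Line a b c r -> Line a' b' c' r -> Line a b c = Line a' b' c'.
Proof.
move=> nz nz' det0 Lr Lr'; have <- : a * r.1 + b * r.2 = c by [].
have <- : a' * r.1 + b' * r.2 = c' by []. clear Lr Lr'.
have n_neq0 := lt0r_neq0 (norm_gt0 nz); pose k := (a * a' + b * b') / (a ^+ 2 + b ^+ 2).
have Da : a' = k * a.
  have -> : k * a = a' + b * (a * b' - a' * b) / (a ^+ 2 + b ^+ 2) by rewrite /k; field.
  by rewrite det0 subrr mulr0 mul0r addr0.
have Db : b' = k * b.
  have -> : k * b = b' - a * (a * b' - a' * b) / (a ^+ 2 + b ^+ 2) by rewrite /k; field.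
  by rewrite det0 subrr mulr0 mul0r subr0.
have nzk : k != 0 by apply/eqP => k0; move: nz'; rewrite Da Db k0 !mul0r eqxx => -[].
rewrite -(Line_scale a b _ nzk) Da Db; congr Line; ring.
Qed.

End Lines.

(** * The plane over a Pythagorean field *)

Section PythagoreanPlane.
Variables (R : realType) (K : R -> Prop).
Hypotheses (K1 : K 1) (KB : forall x y, K x -> K y -> K (x - y))
  (KM : forall x y, K x -> K y -> K (x * y)) (KV : forall x, K x -> x != 0 -> K x^-1)
  (Kpyth : forall x, K x -> exists y, K y /\ y ^+ 2 = 1 + x ^+ 2).

Definition plane_points (p : Defs.point R) := K p.1 /\ K p.2.
Definition plane_lines (l : Defs.point R -> Prop) :=
  exists a b c, [/\ K a, K b, K c, a != 0 \/ b != 0 & l = Line a b c].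

Let KN x : K x -> K (- x). Proof. exact: sub_closedN. Qed.
Let KD x y : K x -> K y -> K (x + y). Proof. exact: sub_closedD. Qed.
Let KX x n : K x -> K (x ^+ n). Proof. exact: sub_closedX. Qed.
Let KI x : K x -> K x^-1. Proof. exact: sub_closed_inv. Qed.
Let K2 : K 2. Proof. exact: sub_closed_nat. Qed.

Local Ltac in_K := repeat first [assumption | apply: KX | apply: KB | apply: KD | apply: KN
  | apply: KM | apply: KI].

Lemma plane_line_unit l : plane_lines l -> exists a b c,
  [/\ K a, K b, K c, a ^+ 2 + b ^+ 2 = 1 & l = Line a b c].
Proof.
move=> [a [b [c [Ka Kb Kc nz ->]]]].
have [s [Ks s2]] : square_in K (a ^+ 2 + b ^+ 2).
  by apply: square_inD => //; apply: square_in_sqr.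
have nzs : s != 0.
  by apply: contraTneq (norm_gt0 nz) => s0; rewrite -s2 s0 expr0n ltxx.
exists (s^-1 * a), (s^-1 * b), (s^-1 * c); split; try in_K.
  by rewrite !exprMn -mulrDr -s2 exprVn mulVf ?expf_neq0.
by rewrite Line_scale ?invr_neq0.
Qed.

(** Along a parametrised line the forms are polynomials of degree at most one in [t] with zero
    product; the values at 0, 1 and -1 show that one of them is zero. *)
Lemma affine_product_on_line a b c a1 b1 c1 a2 b2 c2 : a != 0 \/ b != 0 ->
  (forall r : Defs.point R, Line a b c r ->
    (a1 * r.1 + b1 * r.2 - c1) * (a2 * r.1 + b2 * r.2 - c2) = 0) ->
  (forall r, Line a b c r -> Line a1 b1 c1 r) \/ (forall r, Line a b c r -> Line a2 b2 c2 r).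
Proof.
move=> nz prod0; have nzn := lt0r_neq0 (norm_gt0 nz).
have [f Lf] : exists f, Line a b c f by exists (foot a b c (0, 0)); exact: foot_on.
have param r : Line a b c r -> exists t, r = (f.1 - t * b, f.2 + t * a).
  move=> Lr; exists ((a * (r.2 - f.2) - b * (r.1 - f.1)) / (a ^+ 2 + b ^+ 2)).
  have E : a * (r.1 - f.1) + b * (r.2 - f.2) = 0 by move: Lr Lf; rewrite /Line; lra.
  rewrite [LHS]surjective_pairing; congr (_, _); apply/eqP; rewrite -subr_eq0; apply/eqP.
    transitivity (a * (a * (r.1 - f.1) + b * (r.2 - f.2)) / (a ^+ 2 + b ^+ 2)); first by field.
    by rewrite E mulr0 mul0r.
  transitivity (b * (a * (r.1 - f.1) + b * (r.2 - f.2)) / (a ^+ 2 + b ^+ 2)); first by field.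
  by rewrite E mulr0 mul0r.
have on t : Line a b c (f.1 - t * b, f.2 + t * a) by move: Lf; rewrite /Line /=; lra.
pose u1 := a1 * f.1 + b1 * f.2 - c1; pose v1 := b1 * a - a1 * b.
pose u2 := a2 * f.1 + b2 * f.2 - c2; pose v2 := b2 * a - a2 * b.
have prod t : (u1 + t * v1) * (u2 + t * v2) = 0.
  by rewrite -(prod0 _ (on t)) /u1 /u2 /v1 /v2 /=; ring.
have uu : u1 * u2 = 0 by rewrite -(prod 0); ring.
have vv : v1 * v2 = 0 by have := prod 1; have := prod (-1); lra.
have uv : u1 * v2 + v1 * u2 = 0 by have := prod 1; have := prod (-1); lra.
have [[u0 v0]|[u0 v0]] : (u1 = 0 /\ v1 = 0) \/ (u2 = 0 /\ v2 = 0).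
- have [u0|nzu] := eqVneq u1 0.
    have [v0|nzv] := eqVneq v1 0; [by left | right].
    move: uv vv; rewrite u0 mul0r add0r => /eqP; rewrite mulf_eq0 (negPf nzv) => /eqP u20.
    by move=> /eqP; rewrite mulf_eq0 (negPf nzv) => /eqP.
  right; move/eqP: uu; rewrite mulf_eq0 (negPf nzu) => /eqP u20.
  by move/eqP: uv; rewrite u20 mulr0 addr0 mulf_eq0 (negPf nzu) => /eqP.
- left=> r /param[t ->]; rewrite /Line /=.
  transitivity (u1 + t * v1 + c1); first by rewrite /u1 /v1; ring.
  by rewrite u0 v0 mulr0 !add0r.
right=> r /param[t ->]; rewrite /Line /=.
transitivity (u2 + t * v2 + c2); first by rewrite /u2 /v2; ring.
by rewrite u0 v0 mulr0 !add0r.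
Qed.

Lemma Line_incl a b c a' b' c' : a != 0 \/ b != 0 -> a' != 0 \/ b' != 0 ->
  (forall r : Defs.point R, Line a b c r -> Line a' b' c' r) -> Line a b c = Line a' b' c'.
Proof.
move=> nz nz' sub; have Lf := foot_on c (0, 0) nz; set f := foot _ _ _ _ in Lf.
have Lg : Line a b c (f.1 - b, f.2 + a) by move: Lf; rewrite /Line /=; lra.
apply: (Line_eq nz nz' _ Lf (sub _ Lf)).
by have := sub _ Lf; have := sub _ Lg; rewrite /Line /=; lra.
Qed.

(** For unit normals the equality of squared forms factors as a difference of squares, so [M] is one
    of the two bisectors. *)
Lemma plane_equidistant a1 b1 c1 a2 b2 c2 (M : Defs.point R -> Prop) :
  K a1 -> K b1 -> K c1 -> K a2 -> K b2 -> K c2 ->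
  a1 ^+ 2 + b1 ^+ 2 = 1 -> a2 ^+ 2 + b2 ^+ 2 = 1 ->
  ~ (forall x, Line a1 b1 c1 x <-> Line a2 b2 c2 x) -> is_line M ->
  equidistant M (Line a1 b1 c1) (Line a2 b2 c2) -> plane_lines M.
Proof.
move=> Ka1 Kb1 Kc1 Ka2 Kb2 Kc2 n1 n2 neq [a [b [c [nz /pred_ext ->]]]].
rewrite -/(Line a b c).
have nz1 : a1 != 0 \/ b1 != 0 by apply: norm_neq0; rewrite n1 oner_neq0.
rewrite equidistant_Line // ?n1 // => eqd.
have [|sub|sub] := @affine_product_on_line a b c (a1 - a2) (b1 - b2) (c1 - c2)
    (a1 + a2) (b1 + b2) (c1 + c2) nz.
- by move=> r /eqd /eqP; rewrite -subr_eq0 => /eqP <-; ring.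
- have [z|nz'] := eqVneq ((a1 - a2) ^+ 2 + (b1 - b2) ^+ 2) 0; last first.
    exists (a1 - a2), (b1 - b2), (c1 - c2); split; try in_K; first exact: norm_neq0.
    by apply: Line_incl => //; apply: norm_neq0.
  (* Equal normals and a point of [M] give [c1 = c2], so the two lines would coincide. *)
  case: neq => x; move/eqP: z; rewrite paddr_eq0 ?sqr_ge0 // !sqrf_eq0 !subr_eq0.
  move=> /andP[/eqP Ea /eqP Eb]; have := sub _ (foot_on c (0, 0) nz).
  by rewrite Ea Eb /Line !subrr !mul0r addr0 => /esym/eqP; rewrite subr_eq0 => /eqP ->.
- have [z|nz'] := eqVneq ((a1 + a2) ^+ 2 + (b1 + b2) ^+ 2) 0; last first.
    exists (a1 + a2), (b1 + b2), (c1 + c2); split; try in_K; first exact: norm_neq0.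
    by apply: Line_incl => //; apply: norm_neq0.
  case: neq => x; move/eqP: z; rewrite paddr_eq0 ?sqr_ge0 // !sqrf_eq0 !addr_eq0.
  move=> /andP[/eqP Ea /eqP Eb]; have := sub _ (foot_on c (0, 0) nz).
  rewrite Ea Eb /Line !addNr !mul0r addr0 => /esym/eqP; rewrite addr_eq0 => /eqP ->.
  by split=> E; lra.
Qed.

Lemma origami_plane : origami_pair plane_points plane_lines.
Proof.
split; first by move=> l [a [b [c [_ _ _ nz ->]]]]; exact: is_line_Line.
split.
  move=> l1 l2 [a [b [c [Ka Kb Kc nz ->]]]] [a' [b' [c' [Ka' Kb' Kc' nz' ->]]]] p uniq_p.
  have [Lp Lp'] := (uniq_p p).2 erefl.
  (* Lines with proportional normals through [p] coincide, which yields a second common point. *)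
  have nzD : a * b' - a' * b != 0.
    apply/eqP => D0; have E : (p.1 - b, p.2 + a) = p.
      apply/uniq_p; rewrite (Line_eq nz nz' _ Lp Lp'); last by lra.
      split; rewrite /Line /=; move: Lp'; rewrite /Line; lra.
    move: (congr1 fst E) (congr1 snd E) => /= E1 E2.
    by case: nz => /eqP; apply; lra.
  move: Lp Lp'; rewrite /Line => Lp Lp'; split.
    have -> : p.1 = (c * b' - c' * b) / (a * b' - a' * b) by rewrite -Lp -Lp'; field.
    by in_K.
  have -> : p.2 = (a * c' - a' * c) / (a * b' - a' * b) by rewrite -Lp -Lp'; field.
  by in_K.
split.
  move=> [p1 p2] [q1 q2] [/= Kp1 Kp2] [/= Kq1 Kq2] /pair_neq /= nz.
  rewrite line_throughE /=; eexists _, _, _; split=> //; try in_K.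
  by case: nz => nz; [right; rewrite -opprB oppr_eq0 | left].
split.
  move=> [p1 p2] [q1 q2] [/= Kp1 Kp2] [/= Kq1 Kq2] /pair_neq /= nz.
  rewrite perp_bisectorE /=; eexists _, _, _; split=> //; try in_K.
  by case: nz => nz; [left | right]; rewrite mulf_neq0 ?pnatr_eq0.
split.
  move=> L1 L2 /plane_line_unit[a1 [b1 [c1 [Ka1 Kb1 Kc1 n1 ->]]]].
  move=> /plane_line_unit[a2 [b2 [c2 [Ka2 Kb2 Kc2 n2 ->]]]] neq M lineM.
  exact: plane_equidistant neq lineM.
move=> L1 L2 [a [b [c [Ka Kb Kc nz ->]]]] [a' [b' [c' [Ka' Kb' Kc' nz' ->]]]].
rewrite reflect_Line //; eexists _, _, _; split=> //; try in_K.
apply: norm_neq0.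
have -> : forall n k : R, n = a ^+ 2 + b ^+ 2 -> k = 2 * (a * a' + b * b') ->
    (n * a' - k * a) ^+ 2 + (n * b' - k * b) ^+ 2 = n ^+ 2 * (a' ^+ 2 + b' ^+ 2) => //.
  by move=> n k -> ->; ring.
by rewrite mulf_neq0 ?expf_neq0 // lt0r_neq0 // norm_gt0.
Qed.

(** Constructible points have coordinates in [K], so a squared distance is a sum of two squares of
    [K], hence a square there. *)
Lemma origami_number_in a : origami_number a -> K a.
Proof.
have K0 : K 0 by exact: sub_closed0.
move=> [v [w [P0v [P0w dist_a]]]].
have closed : origami_closed plane_points by exists plane_lines; exact: origami_plane.
have [Kv1 Kv2] : plane_points v by apply: P0v.
have [Kw1 Kw2] : plane_points w by apply: P0w.
have [s [Ks s2]] : square_in K (sqdist v w).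
  by apply: square_inD => //; apply: square_in_sqr => //; in_K.
move: dist_a; rewrite -s2 sqrtr_sqr => /eqP; rewrite eqr_norm2 => /orP[] /eqP -> //.
exact: KN.
Qed.

End PythagoreanPlane.

(** * Origami constructions *)

Section Constructions.
Variables (R : realType) (P : Defs.point R -> Prop) (L : (Defs.point R -> Prop) -> Prop).
Hypotheses (PL : origami_pair P L) (P00 : P (0, 0)) (P01 : P (0, 1)).
Implicit Types (a b c x y : R) (p q : Defs.point R).

Lemma meet_point a b c a' b' c' p : L (Line a b c) -> L (Line a' b' c') ->
  a * b' - a' * b != 0 -> Line a b c p -> Line a' b' c' p -> P p.
Proof.
case: PL => _ [meet _] L1 L2 nzD Lp Lp'; apply: (meet _ _ L1 L2) => r.
split=> [[Lr Lr']|-> //]; move: Lp Lp' Lr Lr'; rewrite /Line => Lp Lp' Lr Lr'.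
have E1 : (a * b' - a' * b) * (r.1 - p.1) = 0.
  transitivity (b' * (a * r.1 + b * r.2 - c) - b * (a' * r.1 + b' * r.2 - c')).
    by rewrite -{1}Lp -Lp'; ring.
  by rewrite Lr Lr' !subrr !mulr0 subrr.
have E2 : (a * b' - a' * b) * (r.2 - p.2) = 0.
  transitivity (a * (a' * r.1 + b' * r.2 - c') - a' * (a * r.1 + b * r.2 - c)).
    by rewrite -{1}Lp -Lp'; ring.
  by rewrite Lr Lr' !subrr !mulr0 subrr.
move: E1 E2 => /eqP + /eqP; rewrite !mulf_eq0 (negPf nzD) !subr_eq0 => /eqP E1 /eqP E2.
by rewrite [r]surjective_pairing [p]surjective_pairing E1 E2.
Qed.

Lemma line_join p q a b c : P p -> P q -> p <> q -> a != 0 \/ b != 0 ->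
  Line a b c p -> Line a b c q -> L (Line a b c).
Proof.
case: PL => _ [_ [join _]] Pp Pq neq nz Lp Lq.
rewrite -(_ : line_through p q = Line a b c); first exact: join.
rewrite line_throughE; apply: (@Line_eq R _ _ _ _ _ _ p) => //.
- case: (pair_neq neq) => nz'; [right | left] => //.
  by rewrite -opprB oppr_eq0.
- by move: Lp Lq; rewrite /Line; lra.
- by rewrite /Line; ring.
Qed.

Lemma line_bisector p q : P p -> P q -> p <> q ->
  L (Line (2 * (q.1 - p.1)) (2 * (q.2 - p.2)) (q.1 ^+ 2 + q.2 ^+ 2 - p.1 ^+ 2 - p.2 ^+ 2)).
Proof. by case: PL => _ [_ [_ [bis _]]] Pp Pq neq; rewrite -perp_bisectorE; apply: bis. Qed.

(** The factor [k] absorbs the scaling of the equation given by [reflect_Line]. *)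
Lemma line_reflect k a b c a1 b1 c1 a2 b2 c2 : L (Line a b c) -> L (Line a1 b1 c1) ->
  a != 0 \/ b != 0 -> k != 0 ->
  let n := a ^+ 2 + b ^+ 2 in let m := 2 * (a * a1 + b * b1) in
  k * a2 = n * a1 - m * a -> k * b2 = n * b1 - m * b -> k * c2 = n * c1 - m * c ->
  L (Line a2 b2 c2).
Proof.
case: PL => _ [_ [_ [_ [_ refl]]]] L0 L1 nz nzk n m Ea Eb Ec.
by rewrite -(Line_scale _ _ _ nzk) Ea Eb Ec -reflect_Line //; apply: refl.
Qed.

(** Subtracting equations whose normals have equal length gives a bisector. The equidistance axiom
    concerns distinct lines; if the two coincide, the difference is the same line again. *)
Lemma line_equidistant a b c a' b' c' : L (Line a b c) -> L (Line a' b' c') ->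
  a != 0 \/ b != 0 -> a' ^+ 2 + b' ^+ 2 = a ^+ 2 + b ^+ 2 ->
  a - a' != 0 \/ b - b' != 0 -> L (Line (a - a') (b - b') (c - c')).
Proof.
case: PL => _ [_ [_ [_ [equi _]]]] L1 L2 nz eqn nzd.
have eqd : equidistant (Line (a - a') (b - b') (c - c')) (Line a b c) (Line a' b' c').
  apply/equidistant_Line => // r Mr; congr (_ ^+ 2).
  by move: Mr; rewrite /Line => Mr; lra.
have [same|neq] := pselect (forall r, Line a b c r <-> Line a' b' c' r); last first.
  by apply: equi neq _ _ eqd => //; exact: is_line_Line.
have E := pred_ext same.
have Lf := foot_on c (0, 0) nz; set f := foot _ _ _ _ in Lf.
have Lg : Line a b c (f.1 - b, f.2 + a) by move: Lf; rewrite /Line /=; lra.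
have Lf' := (same _).1 Lf; have Lg' := (same _).1 Lg.
have nzn := norm_gt0 nz.
rewrite (_ : Line (a - a') (b - b') (c - c') = Line a b c) //.
apply: (@Line_eq R _ _ _ _ _ _ f) => //.
  by move: Lf' Lg'; rewrite /Line /=; lra.
by move: Lf Lf'; rewrite /Line /=; lra.
Qed.

Definition vertical x := L (Line 1 0 x).
Definition horizontal y := L (Line 0 1 y).

Let nz10 : (1 : R) != 0 \/ (0 : R) != 0. Proof. by left; apply: oner_neq0. Qed.
Let nz01 : (0 : R) != 0 \/ (1 : R) != 0. Proof. by right; apply: oner_neq0. Qed.
Let nz1 : (1 : R) != 0. Proof. exact: oner_neq0. Qed.
Let nz2 : (2 : R) != 0. Proof. by rewrite pnatr_eq0. Qed.

Lemma vertical0 : vertical 0.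
Proof.
apply: (line_join P00 P01) => //; rewrite /Line /=; [|ring|ring].
by case=> /esym/eqP; rewrite oner_eq0.
Qed.

Lemma horizontal_reflect x y : horizontal x -> horizontal y -> horizontal (2 * x - y).
Proof.
move=> Hx Hy; apply: (line_reflect (k := -1) Hx Hy) => //; try ring.
by rewrite oppr_eq0.
Qed.

Lemma vertical_reflect x y : vertical x -> vertical y -> vertical (2 * x - y).
Proof.
move=> Hx Hy; apply: (line_reflect (k := -1) Hx Hy) => //; try ring.
by rewrite oppr_eq0.
Qed.

Lemma horizontal_half y : P (0, y) -> y != 0 -> horizontal (y / 2).
Proof.
move=> P0y nzy; have := line_bisector P00 P0y; rewrite /=.
rewrite /horizontal -(Line_scale 0 1 (y / 2) (k := 2 * y)) ?mulf_neq0 //.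
have -> : 2 * (0 - 0) = 2 * y * 0 :> R by ring.
have -> : 2 * (y - 0) = 2 * y * 1 by ring.
have -> : 0 ^+ 2 + y ^+ 2 - 0 ^+ 2 - 0 ^+ 2 = 2 * y * (y / 2) by field.
by apply; case=> /esym/eqP; rewrite (negPf nzy).
Qed.

(** The x-axis is the reflection of the line at height 1/2 in the one at height 1/4, both being
    perpendicular bisectors. *)
Lemma horizontal0 : horizontal 0.
Proof.
have H2 : horizontal (1 / 2) by apply: horizontal_half.
have P2 : P (0, 1 / 2).
  by apply: (meet_point vertical0 H2); rewrite /Line /=; [rewrite mulr1 mul0r subr0|ring|ring].
have H4 : horizontal (1 / 2 / 2) by apply: horizontal_half; rewrite ?mulf_neq0 ?invr_neq0.
by have := horizontal_reflect H4 H2; congr horizontal; field.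
Qed.

Lemma horizontal1 : horizontal 1.
Proof.
have H2 : horizontal (1 / 2) by apply: horizontal_half.
by have := horizontal_reflect H2 horizontal0; congr horizontal; field.
Qed.

Lemma diagonal : L (Line 1 (-1) 0).
Proof.
have := line_equidistant vertical0 horizontal0; rewrite subr0 sub0r subrr; apply=> //.
  by ring.
by left.
Qed.

Lemma vertical_horizontal x : vertical x <-> horizontal x.
Proof.
by split=> H; apply: (line_reflect (k := 2) diagonal H) => //; try ring; left.
Qed.

Lemma vertical1 : vertical 1. Proof. exact/vertical_horizontal/horizontal1. Qed.

Lemma grid_point x y : vertical x -> vertical y -> P (x, y).
Proof.
move=> Vx /vertical_horizontal Hy.
by apply: (meet_point Vx Hy); rewrite /Line /=; [rewrite mulr1 mul0r subr0|ring|ring].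
Qed.

Lemma vertical_half x : vertical x -> vertical (x / 2).
Proof.
have [->|nzx] := eqVneq x 0; first by rewrite mul0r.
move=> Vx; apply/vertical_horizontal; apply: horizontal_half => //.
exact: grid_point vertical0 Vx.
Qed.

(** Reflecting the line at [y] in the line at [x / 2] lands at [x - y]. *)
Lemma verticalB x y : vertical x -> vertical y -> vertical (x - y).
Proof.
move=> /vertical_half Vx Vy; have := vertical_reflect Vx Vy.
by congr vertical; field.
Qed.

(** The lines from [(0, 0)] and [(0, 1)] to the point, reflected in the y-axis, meet at [(- x, y)],
    whose join with [(x, y)] is horizontal. On the y-axis itself, reflect the x-axis in the line at
    height [y / 2]. *)
Lemma point_horizontal x y : P (x, y) -> horizontal y.
Proof.
move=> Pxy; have [x0|nzx] := eqVneq x 0.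
  have [->|nzy] := eqVneq y 0; first exact: horizontal0.
  rewrite x0 in Pxy; have := horizontal_reflect (horizontal_half Pxy nzy) horizontal0.
  by congr horizontal; field.
have L1 : L (Line y (- x) 0).
  apply: (line_join P00 Pxy); rewrite /Line /=; [|right; by rewrite oppr_eq0|ring|ring].
  by case=> /esym/eqP; rewrite (negPf nzx).
have L2 : L (Line (y - 1) (- x) (- x)).
  apply: (line_join P01 Pxy); rewrite /Line /=; [|right; by rewrite oppr_eq0|ring|ring].
  by case=> /esym/eqP; rewrite (negPf nzx).
have L1' : L (Line (- y) (- x) 0).
  by apply: (line_reflect (k := 1) vertical0 L1) => //; ring.
have L2' : L (Line (1 - y) (- x) (- x)).
  by apply: (line_reflect (k := 1) vertical0 L2) => //; ring.
have PNxy : P (- x, y).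
  apply: (meet_point L1' L2'); rewrite /Line /=; [|ring|ring].
  by rewrite (_ : _ - _ = x) //; ring.
apply: (line_join Pxy PNxy) => //; rewrite /Line /=; [|ring|ring].
by case=> /eqP; rewrite -subr_eq0 opprK -mulr2n mulrn_eq0 (negPf nzx).
Qed.

(** The line through [(0, 0)] and [(1, y)] has height [x * y] at abscissa [x]. *)
Lemma verticalM x y : vertical x -> vertical y -> vertical (x * y).
Proof.
move=> Vx Vy; have [->|nzx] := eqVneq x 0; first by rewrite mul0r; exact: vertical0.
apply/vertical_horizontal; apply: (@point_horizontal x).
have L1 : L (Line y (-1) 0).
  apply: (line_join P00 (grid_point vertical1 Vy)); rewrite /Line /=; [|right|ring|ring].
    by case=> /esym/eqP; rewrite oner_eq0.
  by rewrite oppr_eq0.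
apply: (meet_point Vx L1); rewrite /Line /=; [|ring|ring].
by rewrite mulr0 subr0 mul1r oppr_eq0.
Qed.

(** The line through [(0, 0)] and [(x, 1)] has height [x^-1] at abscissa 1. *)
Lemma verticalV x : vertical x -> x != 0 -> vertical x^-1.
Proof.
move=> Vx nzx; apply/vertical_horizontal; apply: (@point_horizontal 1).
have L1 : L (Line 1 (- x) 0).
  apply: (line_join P00 (grid_point Vx vertical1)); rewrite /Line /=; [|by left|ring|ring].
  by case=> /esym/eqP; rewrite (negPf nzx).
apply: (meet_point vertical1 L1); rewrite /Line /=; [|ring|by field].
by rewrite mulr0 subr0 mul1r oppr_eq0.
Qed.

(* Reflecting in the bisector of the x-axis and the line through (0,0) and (1,x) carries the
   perpendicular to that line at (1,x) to the vertical line at the distance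
   from (0,0) to (1,x). *)
Lemma vertical_sqrt x : vertical x -> vertical (Num.sqrt (1 + x ^+ 2)).
Proof.
move=> Vx; set s := Num.sqrt _.
have s2 : s ^+ 2 = 1 + x ^+ 2 by rewrite sqr_sqrtr // addr_ge0 ?sqr_ge0.
have s_gt0 : 0 < s by rewrite sqrtr_gt0 ltr_pwDl ?sqr_ge0.
have [x0|nzx] := eqVneq x 0; first by rewrite /s x0 expr0n addr0 sqrtr1; exact: vertical1.
have nzs : s != 0 by rewrite lt0r_neq0.
have nzs1 : 1 + s != 0 by rewrite lt0r_neq0 // addr_gt0.
have L1 : L (Line x (-1) 0).
  apply: (line_join P00 (grid_point vertical1 Vx)); rewrite /Line /=; [|by left|ring|ring].
  by case=> /esym/eqP; rewrite oner_eq0.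
have L0 : L (Line 0 s 0).
  have := horizontal0; rewrite /horizontal -(Line_scale 0 1 0 nzs).
  by rewrite !mulr0 mulr1.
have Vx2 : vertical (1 + x ^+ 2).
  have := verticalB vertical1 (verticalB vertical0 (verticalM Vx Vx)).
  by congr vertical; ring.
have L2 : L (Line 1 x (1 + x ^+ 2)).
  apply: (line_join (grid_point vertical1 Vx) (grid_point Vx2 vertical0));
    rewrite /Line /=; [|by left|ring|ring].
  by case=> _ /eqP; rewrite (negPf nzx).
(* The normals [(x, -1)] and [(0, s)] both have length [s]. *)
have Lb : L (Line x (-1 - s) 0).
  have := line_equidistant L1 L0; rewrite !subr0; apply; [by left| |by left].
  by rewrite s2; ring.
(* The scale is [2 * s * (1 + s)], the squared length of the bisector's normal, times [s], the
   length of the normal [(1, x)] that is carried to a multiple of [(1, 0)]. *)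
apply: (line_reflect (k := 2 * s ^+ 2 * (1 + s)) Lb L2); rewrite ?mulf_neq0 ?expf_neq0 //.
- by left.
- have -> : x ^+ 2 = s ^+ 2 - 1 by rewrite s2; ring.
  have -> : 2 * (x * 1 + (-1 - s) * x) * x = 2 * (- s) * x ^+ 2 by ring.
  have -> : x ^+ 2 = s ^+ 2 - 1 by rewrite s2; ring.
  by ring.
- transitivity (2 * s * x * (1 + x ^+ 2 - s ^+ 2) / (2 * s)); first by rewrite s2; field.
  have -> : x ^+ 2 = s ^+ 2 - 1 by rewrite s2; ring.
  by field.
- have -> : x ^+ 2 = s ^+ 2 - 1 by rewrite s2; ring.
  by ring.
Qed.

Lemma vertical_point x : vertical x <-> P (x, 0).
Proof.
split=> [Vx|Px]; first exact: grid_point Vx vertical0.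
have [->|nzx] := eqVneq x 0; first exact: vertical0.
have L1 := line_bisector P00 Px.
have V2 : vertical (x / 2).
  move: L1; rewrite /vertical -(Line_scale 1 0 (x / 2) (k := 2 * x)) ?mulf_neq0 //=.
  have -> : 2 * (0 - 0) = 2 * x * 0 :> R by ring.
  have -> : 2 * (x - 0) = 2 * x * 1 by ring.
  have -> : x ^+ 2 + 0 ^+ 2 - 0 ^+ 2 - 0 ^+ 2 = 2 * x * (x / 2) by field.
  by apply; case=> /esym/eqP; rewrite (negPf nzx).
by have := vertical_reflect V2 vertical0; congr vertical; field.
Qed.

End Constructions.

(** * The three descriptions inside the complex numbers *)

Section Complex.
Variable R : realType.
Local Open Scope complex_scope.
Implicit Types z w : R[i].

Lemma totally_realE z : totally_real z <-> conj_real z.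
Proof.
split=> [[p [[mon_p [pz min_p]] real_p]]|[p [mon_p pz min_p real_p]]]; exists p.
  by split=> // w /real_p/Creal_ImP.
by split=> // w /real_p/Creal_ImP.
Qed.

Lemma F_sqrtx_constructible z : F_sqrtx z -> constructible z.
Proof.
apply; first split; first exact: constructible1.
  split; first exact: constructibleB.
  split; first exact: constructibleM.
  by move=> x Sx _; apply: constructibleV.
move=> x Sx; exists (sqrtC x); rewrite sqrtCK; split=> //.
by apply: constructible_sqrt Sx; rewrite sqrtCK.
Qed.

Lemma F_sqrt1x2_conj_real z : F_sqrt1x2 z -> conj_real z.
Proof.
apply; first split; first exact: conj_real1.
  split; first exact: conj_realB.
  split; first exact: conj_realM.
  by move=> x Sx _; apply: conj_realV.
move=> x Sx; exists (sqrtC (1 + x ^+ 2)); rewrite sqrtCK; split=> //.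
by apply: conj_real_sqrt1x2 Sx _; rewrite sqrtCK.
Qed.

Lemma F_sqrt1x2_sqrtx z : F_sqrt1x2 z -> F_sqrtx z.
Proof.
move=> Fz S sfS sqrtS; apply: Fz => // x Sx; apply: sqrtS.
have [S1 [SB [SM _]]] := sfS.
by apply: sub_closedD => //; rewrite expr2; apply: SM.
Qed.

Lemma F_sqrt1x2_subfield : is_subfield (@F_sqrt1x2 R).
Proof.
split; first by move=> S [].
split; first by move=> x y Fx Fy S sfS pS; have [_ [SB _]] := sfS; apply: SB; [apply: Fx | apply: Fy].
split; first by move=> x y Fx Fy S sfS pS; have [_ [_ [SM _]]] := sfS; apply: SM; [apply: Fx | apply: Fy].
by move=> x Fx nzx S sfS pS; have [_ [_ [_ SV]]] := sfS; apply: SV => //; apply: Fx.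
Qed.

(** Each competing subfield contains some root and with it the opposite one, so the intersection
    contains both. *)
Lemma F_sqrt1x2_sqrt (x y : R[i]) : F_sqrt1x2 x -> y ^+ 2 = 1 + x ^+ 2 -> F_sqrt1x2 y.
Proof.
move=> Fx y2 S sfS pS; have [w [Sw w2]] := pS x (Fx S sfS pS).
have [S1 [SB _]] := sfS.
move/eqP: y2; rewrite -w2 eqf_sqr => /orP[] /eqP -> //; exact: sub_closedN.
Qed.

Lemma origami_number_F_sqrt1x2 (a : R) : origami_number a -> F_sqrt1x2 a%:C.
Proof.
have [F1 [FB [FM FV]]] := F_sqrt1x2_subfield.
apply: (@origami_number_in R (fun x => F_sqrt1x2 x%:C)) => [//|x y Fx Fy|x y Fx Fy|x Fx nzx|x Fx].
- by rewrite rmorphB; apply: FB.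
- by rewrite rmorphM; apply: FM.
- by rewrite fmorphV; apply: FV => //; rewrite fmorph_eq0.
- have s2 : Num.sqrt (1 + x ^+ 2) ^+ 2 = 1 + x ^+ 2 by rewrite sqr_sqrtr // addr_ge0 ?sqr_ge0.
  exists (Num.sqrt (1 + x ^+ 2)); split=> //; apply: F_sqrt1x2_sqrt Fx _.
  by rewrite -!rmorphXn s2 rmorphD rmorph1.
Qed.

Lemma F_sqrt1x2_origami_number z : F_sqrt1x2 z -> exists a : R, origami_number a /\ z = a%:C.
Proof.
(* Abscissas of constructible points on the x-axis. In each origami pair these give vertical lines,
   so the closure properties proved for vertical lines make [S] a competing subfield. *)
pose S w := exists2 a : R, w = a%:C & P0 (a, 0).
have vP (a : R) : (forall P L, origami_pair P L -> P (0, 0) -> P (0, 1) -> vertical L a) -> P0 (a, 0).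
  by move=> V P P00 P01 [L PL]; apply/(vertical_point PL P00 P01); apply: V PL _ _.
have Pv (a : R) : P0 (a, 0) -> forall P L, origami_pair P L -> P (0, 0) -> P (0, 1) -> vertical L a.
  by move=> P0a P L PL P00 P01; apply/(vertical_point PL P00 P01); apply: P0a => //; exists L.
have sfS : is_subfield S.
  split; first by exists 1; rewrite ?rmorph1 //; apply: vP => P L PL P00 P01; apply: vertical1 PL P00 P01.
  split.
    move=> _ _ [a -> /Pv Va] [b -> /Pv Vb]; exists (a - b); first by rewrite rmorphB.
    by apply: vP => P L PL P00 P01; apply: (verticalB PL P00 P01); [apply: Va PL _ _ | apply: Vb PL _ _].
  split.
    move=> _ _ [a -> /Pv Va] [b -> /Pv Vb]; exists (a * b); first by rewrite rmorphM.
    by apply: vP => P L PL P00 P01; apply: (verticalM PL P00 P01); [apply: Va PL _ _ | apply: Vb PL _ _].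
  move=> _ [a -> /Pv Va]; rewrite fmorph_eq0 => nza; exists a^-1; first by rewrite fmorphV.
  by apply: vP => P L PL P00 P01; apply: (verticalV PL P00 P01) => //; apply: Va PL _ _.
have pS x : S x -> exists y, S y /\ y ^+ 2 = 1 + x ^+ 2.
  move=> [a -> /Pv Va]; exists (Num.sqrt (1 + a ^+ 2))%:C; split.
    exists (Num.sqrt (1 + a ^+ 2)) => //; apply: vP => P L PL P00 P01.
    by apply: (vertical_sqrt PL P00 P01); apply: Va PL _ _.
  by rewrite -!rmorphXn sqr_sqrtr ?addr_ge0 ?sqr_ge0 // rmorphD rmorph1.
move=> /(_ S sfS pS)[a -> P0a]; exists a; split=> //; exists (a, 0), (0, 0).
split=> //; split; first by move=> P.
by rewrite /sqdist /= !subr0 expr0n addr0 sqrtr_sqr.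
Qed.

End Complex.

Local Open Scope complex_scope.

Theorem mainTheorem11 (R : realType) (z : R[i]) :
  ((exists a : R, origami_number a /\ z = a%:C) <-> F_sqrt1x2 z) /\
  (F_sqrt1x2 z <-> (F_sqrtx z /\ totally_real z)).
Proof.
split; split.
- by move=> [a [oa ->]]; exact: origami_number_F_sqrt1x2.
- exact: F_sqrt1x2_origami_number.
- move=> Fz; split; first exact: F_sqrt1x2_sqrtx.
  exact/totally_realE/F_sqrt1x2_conj_real.
- move=> [/F_sqrtx_constructible cz /totally_realE rz] S [S1 [SB [SM SV]]] pS.
  exact: constructible_conj_real_in.
Qed.
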